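(* For a word $w=x^{a_1}y\,x^{a_2}y\cdots x^{a_L}y$ in noncommuting letters $x,y$ (with $a_1\ge1$, $a_2,\dots,a_L\ge 0$) and $\lambda\in\mathbb{C}\setminus\mathbb{Z}_{\ge1}$, set $$F(w;\lambda)=\sum_{n_1>\dots>n_L>0}\ \prod_{r=1}^{L}\frac{1}{n_r^{a_r}(n_r-\lambda)}.$$ For integers $k_1,l_1,\dots,k_m,l_m\ge 0$ with $k_1,l_m\ge1$ set $f(\{k_i,l_i\}_{i=1}^m;\lambda)=F(x^{k_1}y^{l_1}x^{k_2}y^{l_2}\cdots x^{k_m}y^{l_m};\lambda)$ and $g(\{k_i,l_i\}_{i=1}^m;\lambda)=F(x^{l_m}y^{k_m}x^{l_{m-1}}y^{k_{m-1}}\cdots x^{l_1}y^{k_1};\lambda)$. Let $I=\{(0,0),(1,0),(0,1)\}$, $\lambda'=\lambda-1$, and for a family of indices $\delta_i,\epsilon_i$ write $|\delta|=\sum\delta_i$, $|\epsilon|=\sum\epsilon_i$ (likewise $|\delta'|,|\epsilon'|$). Let $m\ge1$ and $k_1,l_1,\dots,k_m,l_m\in\mathbb{Z}_{\ge1}$. Then, for all $\lambda\in\mathbb{C}\setminus\mathbb{Z}_{\ge1}$: (i) If $k_1\ne1$ and $l_m\ne1$: $$\sum_{\{(\delta_i,\epsilon_i)\}_{i=1}^m\in I^m}(-\lambda)^{m-|\delta|-|\epsilon|}f(\{k_i-\delta_i,l_i-\epsilon_i\}_{i=1}^m;\lambda)=\sum_{\delta_1'\in\{0,1\}}\ \sum_{\{(\delta_j',\epsilon_j')\}_{j=2}^m\in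 I^{m-1}}\ \sum_{\epsilon_{m+1}'\in\{0,1\}}(-\lambda')^{m-|\delta'|-|\epsilon'|}f(\{k_i-\delta_i',l_i-\epsilon_{i+1}'\}_{i=1}^m;\lambda').$$ (ii) If $k_1=1$ and $l_m\ne1$: $$\sum_{\epsilon_1\in\{0,1\}}\ \sum_{\{(\delta_i,\epsilon_i)\}_{i=2}^m\in I^{m-1}}(-\lambda)^{m-|\delta|-|\epsilon|}f(\{1,l_1-\epsilon_1\}\cup\{k_i-\delta_i,l_i-\epsilon_i\}_{i=2}^m;\lambda)=\sum_{\{(\delta_j',\epsilon_j')\}_{j=2}^m\in I^{m-1}}\ \sum_{\epsilon_{m+1}'\in\{0,1\}}(-\lambda')^{m-|\delta'|-|\epsilon'|}f(\{1,l_1-\epsilon_2'\}\cup\{k_i-\delta_i',l_i-\epsilon_{i+1}'\}_{i=2}^m;\lambda').$$ (iii) If $k_1\ne1$ and $l_m=1$: $$\sum_{\{(\delta_i,\epsilon_i)\}_{i=1}^{m-1}\in I^{m-1}}\ \sum_{\delta_m\in\{0,1\}}(-\lambda)^{m-|\delta|-|\epsilon|}f(\{k_i-\delta_i,l_i-\epsilon_i\}_{i=1}^{m-1}\cup\{k_m-\delta_m,1\};\lambda)=\sum_{\delta_1'\in\{0,1\}}\ \sum_{\{(\delta_j',\epsilon_j')\}_{j=2}^m\in I^{m-1}}(-\lambda')^{m-|\delta'|-|\epsilon'|}f(\{k_i-\delta_i',l_i-\epsilon_{i+1}'\}_{i=1}^{m-1}\cup\{k_m-\delta_m',1\};\lambda').$$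 (iv) If $k_1=l_m=1$ and $m\ge2$: $$\sum_{\epsilon_1\in\{0,1\}}\ \sum_{\{(\delta_i,\epsilon_i)\}_{i=2}^{m-1}\in I^{m-2}}\ \sum_{\delta_m\in\{0,1\}}(-\lambda)^{m-|\delta|-|\epsilon|}f(\{1,l_1-\epsilon_1\}\cup\{k_i-\delta_i,l_i-\epsilon_i\}_{i=2}^{m-1}\cup\{k_m-\delta_m,1\};\lambda)=\sum_{\{(\delta_j',\epsilon_j')\}_{j=2}^m\in I^{m-1}}(-\lambda')^{m-|\delta'|-|\epsilon'|}f(\{1,l_1-\epsilon_2'\}\cup\{k_i-\delta_i',l_i-\epsilon_{i+1}'\}_{i=2}^{m-1}\cup\{k_m-\delta_m',1\};\lambda').$$ Moreover the same four identities hold with $f$ replaced by $g$ throughout.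
   Context: Here $\{a_1,b_1\}\cup\{a_i,b_i\}_{i=2}^m$ denotes the sequence $(a_1,b_1,a_2,b_2,\dots,a_m,b_m)$, and in each sum the exponents $|\delta|,|\epsilon|$ (resp. $|\delta'|,|\epsilon'|$) are the sums of all the $\delta_i,\epsilon_i$ (resp. $\delta_i',\epsilon_i'$) occurring as summation variables in that sum. Since $x^ay^0x^b=x^{a+b}$ and $y^ax^0y^b=y^{a+b}$, entries equal to $0$ are allowed in $f,g$. Equivalently, $f(\{k_i,l_i\};\lambda)=\sum_{n_1>\dots>n_{L_m}>0}\prod_{i=1}^m\big(n_{L_{i-1}+1}^{k_i}\prod_{r=L_{i-1}+1}^{L_i}(n_r-\lambda)\big)^{-1}$ with $L_i=l_1+\dots+l_i$; these are generating functions in $\lambda$ of sums of multiple zeta values of fixed index with total weight increased by the power of $\lambda$, and $g$ corresponds to the dual index. *)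

(* Defs.v *)
From HB Require Import structures.
From mathcomp Require Import all_boot all_order all_algebra.
From mathcomp Require Import all_classical all_reals topology normedtype sequences.
From mathcomp Require Import complex.
Set Implicit Arguments. Unset Strict Implicit. Unset Printing Implicit Defensive.
Import Order.TTheory GRing.Theory Num.Theory.
Import numFieldNormedType.Exports.
Local Open Scope ring_scope.
Local Open Scope complex_scope.
Local Open Scope classical_set_scope.

(* Words in the noncommuting letters x, y: true = x, false = y. *)
Definition xyword (kl : seq (nat * nat)) : seq bool :=
  flatten [seq nseq p.1 true ++ nseq p.2 false | p <- kl].

(* w = x^{a_1} y x^{a_2} y ... x^{a_L} y  |->  [:: a_1; ...; a_L]
   (any trailing x's after the last y are ignored; all words used end in y) *)
Fixpoint word_exps_aux (w : seq bool) (c : nat) : seq nat :=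
  match w with
  | [::] => [::]
  | true :: w' => word_exps_aux w' c.+1
  | false :: w' => c :: word_exps_aux w' 0
  end.
Definition word_exps (w : seq bool) : seq nat := word_exps_aux w 0.

Fixpoint Ftrunc (R : realType) (a : seq nat) (lam : R[i]) (N : nat) : R[i] :=
  match a with
  | [::] => 1
  | a1 :: a' => \sum_(1 <= n < N.+1)
                  ((n%:R ^+ a1 * (n%:R - lam))^-1 * Ftrunc a' lam n.-1)
  end.

Definition Fw (R : realType) (w : seq bool) (lam : R[i]) : R[i] :=
  lim ((Ftrunc (word_exps w) lam : nat -> (R[i])^o) @ \oo).

Definition fS (R : realType) (kl : seq (nat * nat)) (lam : R[i]) : R[i] :=
  Fw (xyword kl) lam.

Definition gS (R : realType) (kl : seq (nat * nat)) (lam : R[i]) : R[i] :=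
  Fw (xyword [seq (p.2, p.1) | p <- rev kl]) lam.

Definition Iset : seq (nat * nat) := [:: (0, 0); (1, 0); (0, 1)]%N.

(* all families (p_i)_{i = lo .. lo+n-1} with p_i in A, as functions
   nat -> nat*nat (value (0,0) outside the index range); each family
   listed exactly once *)
Fixpoint families (A : seq (nat * nat)) (lo n : nat) : seq (nat -> nat * nat) :=
  match n with
  | 0 => [:: fun _ => (0, 0)%N]
  | n'.+1 => flatten [seq [seq (fun i => if i == lo then a else g i)
                          | g <- families A lo.+1 n'] | a <- A]
  end.

(* Main.v *)
Require Import Defs.
From HB Require Import structures.
From mathcomp Require Import all_boot all_order all_algebra.
From mathcomp Require Import all_classical all_reals topology normedtype sequences.
From mathcomp Require Import complex ring lra zify.
From Stdlib Require List.
Import Order.TTheory GRing.Theory Num.Theory.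
Import numFieldNormedType.Exports.
Import ComplexField.Normc.
Set Implicit Arguments. Unset Strict Implicit. Unset Printing Implicit Defensive.
Local Open Scope ring_scope.

(** Fix N and keep only the summation indices at most N.  With the matrices, indexed by 0..N,
    X = diag(1/j) (where 1/0 = 0) and Y_lam(j,i) = [i < j]/(j - lam), the truncated value of F at a
    word w is (1,...,1) w(X,Y_lam) e_0, and sums over the families become products: the left-hand
    side is the word polynomial in which each corner xy of x^{k_1}y^{l_1}...x^{k_m}y^{l_m} is
    replaced by C = x + y - lam xy, and on the right each corner yx is replaced by
    D = x + y - lam' yx, the two ends carrying factors 1 - lam' x and 1 - lam' y.
    Put P = 1 - lam' X, Y = Y_lam, Y' = Y_lam'.  There is an explicit matrix Dn with P Dn = C,
    Dn P = D, and Y' Dn = Dn Y up to a multiple of the column 0.  Pushing Dn through the word turns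
    one side into the other: in cases (i) and (iii) the truncated identity is exact, and in
    (ii) and (iv) the two sides differ by 1/(N+1-lam) times a truncated sum, which is O(N^{1/2}).
    The identities for g follow by transposing all matrices, which reverses words and exchanges
    x and y. *)

(** * Word polynomials and truncated sums *)

Definition xword (A : nzRingType) (x y : A) (w : seq bool) : A :=
  \prod_(b <- w) (if b then x else y).

(* A list of pairs (p,q) stands for the blocks x^{p+1} y^{q+1}, one letter of each kind being
   taken up by the corner element c. *)
Definition Lprod (A : nzRingType) (c x y : A) (s : seq (nat * nat)) : A :=
  \prod_(a <- s) (x ^+ a.1 * c * y ^+ a.2).

Fixpoint Mprod (A : nzRingType) (d x y : A) (s : seq (nat * nat)) : A :=
  match s with
  | [::] => 1
  | a :: s' => x ^+ a.1 * y ^+ a.2 * (if s' is _ :: _ then d * Mprod d x y s' else 1)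
  end.

Definition cornerC (K : nzRingType) (A : algType K) (lam : K) (x y : A) : A := x + y - lam *: (x * y).
Definition cornerD (K : nzRingType) (A : algType K) (lam : K) (x y : A) : A := x + y - lam *: (y * x).

(* The two sides of (i)-(iv); the rhs forms are used at lam' = lam - 1, with y = Y_lam'.  When
   k_1 = 1 the first corner loses its y (that word would start with y), whence x (1 - lam y);
   when l_m = 1 the last one loses its x, whence (1 - lam x) y. *)
Section Forms.
Variables (K : fieldType) (A : algType K) (lam : K) (x y : A).
Let L s := Lprod (cornerC lam x y) x y s.
Let M s := Mprod (cornerD lam x y) x y s.
Definition lhs1 s := L s.
Definition lhs2 q s := x * (1 - lam *: y) * y ^+ q * L s.
Definition lhs3 s p := L s * x ^+ p * ((1 - lam *: x) * y).
Definition lhs4 q s p := x * (1 - lam *: y) * y ^+ q * L s * x ^+ p * ((1 - lam *: x) * y).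
Definition rhs1 s := (- lam)^-1 *: ((1 - lam *: x) * M s * (1 - lam *: y)).
Definition rhs2 q s := x * M ((0, q)%N :: s) * (1 - lam *: y).
Definition rhs3 s p := (1 - lam *: x) * M (rcons s (p, 0)%N) * y.
Definition rhs4 q s p := - lam *: (x * M ((0, q)%N :: rcons s (p, 0)%N) * y).
End Forms.

(** * The truncated matrices and the relations satisfied by [mxDn] *)

Section Truncated.
Variables (K : numFieldType) (N : nat) (lam : K).
Hypothesis lamP : forall n : nat, lam != n.+1%:R.

Definition mxX : 'M[K]_N.+1 := \matrix_(j, i) ((j == i)%:R * (j%:R)^-1).
Definition mxY (lm : K) : 'M[K]_N.+1 := \matrix_(j, i) ((i < j)%N%:R * (j%:R - lm)^-1).
Definition mxC (lm : K) := cornerC lm mxX (mxY lm).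
Definition mxD (lm : K) := cornerD lm mxX (mxY lm).
Definition mxP : 'M[K]_N.+1 := 1 - (lam - 1) *: mxX.
(** This is the solution of P Dn = C with row 0 equal to zero: for j >= 1, row j of [C] is
    [i <= j]/j and the diagonal entry of [P] is (j+1-lam)/j. *)
Definition mxDn : 'M[K]_N.+1 :=
  \matrix_(j, i) ((1 <= j)%N%:R * (i <= j)%N%:R * (j.+1%:R - lam)^-1).
Notation X := mxX.
Notation Y := (mxY lam).
Notation Y' := (mxY (lam - 1)).
Notation C := (mxC lam).
Notation D := (mxD (lam - 1)).
Notation P := mxP.
Notation Dn := mxDn.
Definition e0 : 'cV[K]_N.+1 := delta_mx 0 0.
Definition ones_row : 'rV[K]_N.+1 := const_mx 1.
Notation mu1 := ((1 - lam)^-1).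

Lemma natr_sub_lam_neq0 n : n.+1%:R - lam != 0.
Proof. by rewrite subr_eq0 eq_sym lamP. Qed.

Lemma mxX_mull (A : 'M[K]_N.+1) j i : (X * A) j i = j%:R^-1 * A j i.
Proof.
rewrite mxE (bigD1 j) //= mxE eqxx mul1r big1 ?addr0 // => k kj.
by rewrite mxE eq_sym (negbTE kj) !mul0r.
Qed.

Lemma mxX_mulr (A : 'M[K]_N.+1) j i : (A * X) j i = A j i * i%:R^-1.
Proof.
rewrite mxE (bigD1 i) //= mxE eqxx mul1r big1 ?addr0 // => k kj.
by rewrite mxE (negbTE kj) !(mul0r, mulr0).
Qed.

Lemma mxPE (A : 'M[K]_N.+1) j i : (P * A) j i = (1 - (lam - 1) * j%:R^-1) * A j i.
Proof. by rewrite mulrBl mul1r -scalerAl mxE [X in _ + X]mxE [X in _ - X]mxE mxX_mull; ring. Qed.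

Lemma mxPEr (A : 'M[K]_N.+1) j i : (A * P) j i = A j i * (1 - (lam - 1) * i%:R^-1).
Proof. by rewrite mulrBr mulr1 -scalerAr mxE [X in _ + X]mxE [X in _ - X]mxE mxX_mulr; ring. Qed.

Lemma mxC_def : C = P * Dn.
Proof.
rewrite /mxC /cornerC.
apply/matrixP => j i; rewrite mxPE [LHS]mxE [X in X + _]mxE [X in _ + X]mxE [X in _ - X]mxE mxX_mull !mxE.
case: j => -[|j] hj /=.
  by rewrite invr0; ring.
have h1 := natr_sub_lam_neq0 j; have h2 := natr_sub_lam_neq0 j.+1.
have := h2; rewrite -[in j.+2%:R]natr1 => h3.
have h4 : j.+1%:R != 0 :> K by rewrite pnatr_eq0.
rewrite -val_eqE /=; move: (j.+1%:R) h1 h3 h4 => t h1 h3 h4.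
by case: (ltngtP i j.+1) => [_|_|_] /=; field; rewrite ?h4 ?h1 ?h3.
Qed.

Lemma mxD_def : D = Dn * P.
Proof.
rewrite /mxD /cornerD.
apply/matrixP => j i; rewrite mxPEr [LHS]mxE [X in X + _]mxE [X in _ + X]mxE [X in _ - X]mxE mxX_mulr !mxE.
have h2 := natr_sub_lam_neq0 j.
(* Passing to lam' = lam - 1 turns j - lam' into j+1-lam, the denominator of row j of [Dn]. *)
have e : (j%:R - (lam - 1))^-1 = (j.+1%:R - lam)^-1 by rewrite -natr1; congr (_^-1); ring.
rewrite e -val_eqE /=; move: (nat_of_ord j) (nat_of_ord i) h2 {e} => {}j {}i h2.
case: i => [|i]; rewrite ?invr0; first by case: j h2 => [|n] _ /=; rewrite ?invr0; ring.
have h4 : i.+1%:R != 0 :> K by rewrite pnatr_eq0.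
have := natr_sub_lam_neq0 i.+1.
move: h2; rewrite -[j.+1%:R]natr1 -[i.+2%:R]natr1 => h2 h5.
case: (ltngtP i.+1 j) => [ij|ij|ij] /=.
- have -> : (0 < j)%N by exact: leq_trans ij.
  by rewrite /= mul0r add0r; move: (i.+1%:R) (j%:R) h4 h2 h5 => t r h4 h2 h5; field; rewrite h2 h4.
- by rewrite !(mul0r, mulr0); ring.
- rewrite -ij /= in h2 *; move: (i.+1%:R) h4 h5 => t h4 h5; field; by rewrite h5 h4.
Qed.

(** After the inner index of [Dn * Y] is shifted by one, entry (j,c) of both products is 1/(j+1-lam)
    times a sum of 1/(i+1-lam) over c <= i < j. Only the term i = 0 is missing on the left, as row 0
    of [Dn] is zero, and this term occurs only for c = 0. *)
Lemma mxY_Dn : Y' * Dn = Dn * Y - mu1 *: (Y' * delta_mx 0 0).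
Proof.
apply/matrixP => j c.
have -> (A B : 'M[K]_N.+1) a : (A - a *: B) j c = A j c - a * B j c by rewrite !mxE.
have -> : (Y' * delta_mx 0 0) j c = (c == 0)%:R * Y' j 0.
  rewrite mxE (bigD1 0) //= big1 ?addr0 => [|k k0]; rewrite !mxE ?eqxx /=; last by rewrite (negbTE k0) mulr0.
  by rewrite mulrC.
(* Removing the last index on the left and the first on the right, where the entries of [Y'] and [Y]
   vanish, leaves two sums over N indices that match after the shift. *)
rewrite !mxE big_ord_recr [in RHS]big_ord_recl /= !mxE /=.
have -> : (N < j)%N = false by apply/negbTE; rewrite -leqNgt -ltnS.
rewrite !(mul0r, mulr0, addr0, add0r, ltn0) /=.
have e n : (n%:R - (lam - 1))^-1 = (n.+1%:R - lam)^-1 by rewrite -natr1; congr (_^-1); ring.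
rewrite e.
case: j => -[|j] hj /=.
  by rewrite !big1 => [| i _ | i _]; rewrite ?mxE /=; ring.
(* The correction is moved into the sum, at i = 0, so that the two sides agree term by term. *)
transitivity (\sum_(i < N) (Dn (Ordinal hj) (lift ord0 i) * Y (lift ord0 i) c
   - (i == 0 :> nat)%:R * (c == 0)%:R * ((1 - lam)^-1 * (j.+2%:R - lam)^-1))); last first.
  rewrite big_split /=; congr (_ + _).
  rewrite sumrN; congr (- _); rewrite -!mulr_suml.
  have N0 : (0 < N)%N := leq_ltn_trans (leq0n j) (hj : (j < N)%N).
  rewrite (bigD1 (Ordinal N0)) //= big1 => [|i]; last by rewrite -val_eqE /= => /negbTE ->.
  by rewrite addr0; ring.
apply: eq_bigr => i _; rewrite !mxE /= /bump /= !add1n e !ltnS.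
case: i => -[|i] hi /=.
  by rewrite -val_eqE /= leqn0 [c == 0 :> nat]eq_sym; case: eqP => _ /=; ring.
by case: (c <= i.+1)%N; case: (i < j)%N => /=; ring.
Qed.

Lemma mxDn_e0 : Dn *m e0 = Y' *m e0.
Proof.
rewrite /e0 -!colE; apply/matrixP => j i; rewrite !mxE /=.
by rewrite mulr1 -natr1; congr (_ * _^-1); ring.
Qed.

Lemma mulmx_vec (A B : 'M[K]_N.+1) (v : 'cV[K]_N.+1) : (A * B) *m v = A *m (B *m v).
Proof. exact: (esym (mulmxA _ _ _)). Qed.

Lemma mxX_row0 (v : 'cV[K]_N.+1) i : (X *m v) 0 i = 0 :> K.
Proof. by rewrite mxE big1 // => k _; rewrite mxE invr0 mulr0 mul0r. Qed.

Lemma mxY_row0 lm (v : 'cV[K]_N.+1) i : (mxY lm *m v) 0 i = 0 :> K.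
Proof. by rewrite mxE big1 // => k _; rewrite mxE /= !mul0r. Qed.

Lemma mxC_row0 (v : 'cV[K]_N.+1) i : (C *m v) 0 i = 0 :> K.
Proof.
rewrite /mxC /cornerC.
rewrite !mulmxDl mulNmx -scalemxAl mulmx_vec.
rewrite mxE [X in X + _]mxE mxX_row0 mxY_row0 [X in _ + X]mxE [X in - X]mxE mxX_row0; ring.
Qed.

(* Column 0 of the error term in [mxY_Dn] is invisible to vectors whose entry 0 vanishes. *)
Lemma mxY_Dn_vec q (v : 'cV[K]_N.+1) : v 0 0 = 0 ->
  Y' ^+ q *m (Dn *m v) = Dn *m (Y ^+ q *m v).
Proof.
move=> v0; elim: q => [|q IH]; first by rewrite !expr0 !mul1mx.
rewrite exprS mulmx_vec IH -mulmx_vec mxY_Dn mulmxBl -scalemxAl !mulmx_vec.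
rewrite [Y ^+ q.+1]exprS [(Y * _) *m v]mulmx_vec.
suff z0 : (Y ^+ q *m v) 0 0 = 0.
  suff -> : (delta_mx 0 0 : 'M[K]_N.+1) *m (Y ^+ q *m v) = 0 by rewrite mulmx0 scaler0 subr0.
  move: (_ *m v) z0 => z z0.
  apply/matrixP => i j; rewrite mxE (bigD1 0) //= ord1 big1 => [|k k0]; rewrite !mxE.
    by rewrite z0 mulr0 addr0.
  by rewrite (negbTE k0) andbF mul0r.
by case: q {IH} => [|q]; rewrite ?expr0 ?mul1mx // exprS mulmx_vec mxY_row0.
Qed.

(** This is (1 - lam' Y') e0 divided by -lam' = 1 - lam. Since Y' e0 = Dn e0, the summand
    [mu1 *: e0] cancels exactly the error of [mxY_Dn] at [e0]. *)
Definition E0 : 'cV[K]_N.+1 := mu1 *: e0 + Y' *m e0.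

Lemma mxY_E0 q : (0 < q)%N -> Y' ^+ q *m E0 = Dn *m (Y ^+ q *m e0).
Proof.
case: q => // q _.
have base : Y' *m E0 = Dn *m (Y *m e0).
  rewrite /E0 mulmxDr -scalemxAr -mxDn_e0 -!mulmx_vec mxY_Dn mulmxBl -scalemxAl !mulmx_vec.
  have -> : delta_mx 0 0 *m e0 = e0 by rewrite /e0 mul_delta_mx.
  by rewrite mxDn_e0 addrC subrK.
by rewrite !exprSr !mulmx_vec base mxY_Dn_vec // mxY_row0.
Qed.

Lemma mxP_X : P * X = X * P.
Proof. by rewrite /mxP mulrBl mulrBr mul1r mulr1 -scalerAl -scalerAr. Qed.

(** [Dn] appears at the right end, by the hypothesis on [E], and moves left. At each corner D = Dn
    P, the factor P commutes with the powers of X and meets the incoming Dn, giving C; the new Dn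
    passes the powers of Y', which become powers of Y. *)
Lemma Mprod_vec (s : seq (nat * nat)) (E : 'cV[K]_N.+1) a :
  let t := a :: s in
  Y' ^+ (last a s).2 *m E = Dn *m (Y ^+ (last a s).2 *m e0) ->
  Mprod D X Y' t *m E = X ^+ a.1 *m (Dn *m (Y ^+ a.2 *m (Lprod C X Y s *m e0))).
Proof.
rewrite /=; elim: s a => [|b s IH] a /= hE.
  by rewrite mulr1 mulmx_vec hE /Lprod big_nil mul1mx.
rewrite mulmx_vec [(D * _) *m E]mulmx_vec IH // mxD_def !mulmx_vec.
set z := Lprod _ _ _ s *m e0.
have -> : P *m (X ^+ b.1 *m (Dn *m (Y ^+ b.2 *m z))) = Lprod C X Y (b :: s) *m e0.
  rewrite /Lprod big_cons -/(Lprod C X Y s) mulmx_vec -/z !mulmx_vec mxC_def.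
  by rewrite mulmx_vec -![X ^+ _ *m (P *m _)]mulmx_vec -mulmx_vec (commrX _ mxP_X).
rewrite mxY_Dn_vec //.
(* Entry 0 of the vector vanishes because its leftmost factor is X or C, whose row 0 is zero. *)
rewrite /Lprod big_cons !mulmx_vec; case: b.1 => [|p].
  by rewrite mul1mx mxC_row0.
by rewrite exprS mulmx_vec mxX_row0.
Qed.

Lemma mxP_Mprod (s : seq (nat * nat)) (E : 'cV[K]_N.+1) a :
  Y' ^+ (last a s).2 *m E = Dn *m (Y ^+ (last a s).2 *m e0) ->
  P *m (Mprod D X Y' (a :: s) *m E) = Lprod C X Y (a :: s) *m e0.
Proof.
move=> hE; rewrite (Mprod_vec hE) /Lprod big_cons !mulmx_vec mxC_def mulmx_vec.
by rewrite -![X ^+ _ *m (P *m _)]mulmx_vec -mulmx_vec (commrX _ mxP_X).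
Qed.

(** * Evaluation of matrices and the four truncated identities *)

Definition mxeval (A : 'M[K]_N.+1) : K := (ones_row *m A *m e0) 0 0.

Lemma mxevalE (A : 'M[K]_N.+1) : mxeval A = \sum_j (A *m e0) j 0.
Proof. by rewrite /mxeval -mulmxA mxE; apply: eq_bigr => j _; rewrite mxE mul1r. Qed.

Lemma mxeval_scalar : scalar mxeval.
Proof.
by move=> a A B; rewrite /mxeval mulmxDr mulmxDl -scalemxAr -scalemxAl mxE [X in X + _]mxE.
Qed.

(* Row j >= 1 of Dn is row j+1 of Y, so the column sums telescope. *)
Lemma ones_row_Dn_sub_Y (v : 'cV[K]_N.+1) : v 0 0 = 0 ->
  (ones_row *m (Dn *m v)) 0 0 - (ones_row *m (Y *m v)) 0 0 = (N.+1%:R - lam)^-1 * (ones_row *m v) 0 0.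
Proof.
move=> v0; rewrite !mulmxA !mxE mulr_sumr -sumrB; apply: eq_bigr => i _.
rewrite -mulrBl [ones_row 0 i]mxE mul1r; case: (eqVneq i 0) => [->|i0]; first by rewrite v0 !mulr0.
congr (_ * _); rewrite !mxE -sumrB.
transitivity (\sum_(0 <= j < N.+1) ((i < j.+1)%N%:R * (j.+1%:R - lam)^-1 - (i < j)%N%:R * (j%:R - lam)^-1)).
  rewrite big_mkord; apply: eq_bigr => j _; rewrite !mxE !mul1r ltnS.
  case: (ltnP 0 j) => [j0|]; first by rewrite mul1r.
  rewrite leqn0 => /eqP ->; rewrite leqn0.
  by rewrite -val_eqE /= in i0; rewrite (negbTE i0) /= !mul0r.
by rewrite (telescope_sumr (fun j => (i < j)%N%:R * (j%:R - lam)^-1)) // ltn_ord ltn0 mul1r mul0r subr0.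
Qed.

Lemma trunc_case1 a s : (0 < (last a s).2)%N ->
  (1 - lam)^-1 *: ((1 - (lam - 1) *: X) * Mprod D X Y' (a :: s) * (1 - (lam - 1) *: Y')) *m e0
  = Lprod C X Y (a :: s) *m e0.
Proof.
move=> ls; rewrite -(mxP_Mprod (mxY_E0 ls)) -/mxP.
move: (Mprod _ _ _ _) => M; rewrite -scalemxAl !mulmx_vec !scalemxAr.
congr (_ *m (_ *m _)); rewrite /E0 mulmxBl mul1mx; congr (_ + _).
rewrite -scalemxAl -scalemxAr scalerA -scaleNr -[RHS]scale1r; congr (_ *: _).
have := natr_sub_lam_neq0 0; move=> h; field; exact: h.
Qed.

Lemma trunc_case3 a s : (last a s).2 = 0%N ->
  ((1 - (lam - 1) *: X) * Mprod D X Y' (a :: s) * Y') *m e0 = Lprod C X Y (a :: s) *m e0.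
Proof.
move=> ls; rewrite -(@mxP_Mprod s (Y' *m e0)) ?ls ?expr0 ?mul1mx ?mxDn_e0 //.
by move: (Mprod _ _ _ _) => M; rewrite !mulmx_vec.
Qed.

(** X kills [e0] because 1/0 = 0, so the end factor (1 - lam X) Y acts on [e0] as a full corner.
    Thus for l_m = 1 the left side is again an [Lprod], with last block (p,0). *)
Lemma mxC_e0 : C *m e0 = ((1 - lam *: X) * Y) *m e0.
Proof.
have Xe0 : X *m e0 = 0.
  by rewrite /e0 -colE; apply/matrixP => j i; rewrite !mxE; case: eqP => [->|_]; rewrite ?invr0 ?mulr0 ?mul0r.
rewrite /mxC /cornerC mulrBl mul1r -scalerAl -addrA mulmxDl Xe0 add0r //.
Qed.

Lemma Lprod_rcons0 s p :
  (Lprod C X Y s * X ^+ p * ((1 - lam *: X) * Y)) *m e0 = Lprod C X Y (rcons s (p, 0%N)) *m e0.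
Proof.
by rewrite /Lprod -cats1 big_cat big_seq1 /= expr0 mulr1 mulrA !mulmx_vec mxC_e0 !mulmx_vec.
Qed.

Lemma L_row0 (q : nat) (s : seq (nat * nat)) : ((0 < q) || (s != [::]))%N ->
  (Y ^+ q *m (Lprod C X Y s *m e0)) 0 0 = 0.
Proof.
case: q => [|q] /=; last by rewrite exprS mulmx_vec mxY_row0.
case: s => // -[p q] s _; rewrite expr0 mul1mx /Lprod big_cons !mulmx_vec /=.
by case: p => [|p]; rewrite ?exprS ?mulmx_vec ?mxX_row0 // mul1mx mxC_row0.
Qed.

(** On the left X (1 - lam Y) = C - Y; on the right -lam' X = P - 1 turns Dn A into C A - Dn A. The
    terms C A cancel, leaving Dn A - Y A, whose column sum is the boundary term. The vector [E] is
    [E0] for (ii) and Y' e0 for (iv). *)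
Lemma trunc_case2_aux q s (E : 'cV[K]_N.+1) (A : 'cV[K]_N.+1) :
  ((0 < q) || (s != [::]))%N ->
  Y' ^+ (last (0%N, q) s).2 *m E = Dn *m (Y ^+ (last (0%N, q) s).2 *m e0) ->
  A = Y ^+ q *m (Lprod C X Y s *m e0) ->
  (ones_row *m ((X * (1 - lam *: Y)) *m A)) 0 0
   - (ones_row *m ((- (lam - 1)) *: (X * Mprod D X Y' ((0%N, q) :: s)) *m E)) 0 0
  = (N.+1%:R - lam)^-1 * (ones_row *m A) 0 0.
Proof.
move=> hq hE eA; have A0 : A 0 0 = 0 by rewrite eA L_row0.
rewrite -(ones_row_Dn_sub_Y A0) -scalemxAl [(X * Mprod _ _ _ _) *m _]mulmx_vec (Mprod_vec hE) /= expr0 mul1mx -eA.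
have -> : - (lam - 1) *: (X *m (Dn *m A)) = C *m A - Dn *m A.
  by rewrite mxC_def mulmx_vec /mxP mulmxBl mul1mx -scalemxAl scaleNr [RHS]addrAC subrr add0r.
have -> : X * (1 - lam *: Y) = C - Y.
  by rewrite /mxC /cornerC mulrBr mulr1 -scalerAr addrAC addrK.
rewrite mulmxBl !mulmxBr; move: (ones_row *m (C *m A)) (ones_row *m (Y *m A)) (ones_row *m (Dn *m A)) => a b c.
by rewrite !mxE; ring.
Qed.

Lemma mxeval_eq (A B : 'M[K]_N.+1) : A *m e0 = B *m e0 -> mxeval A = mxeval B.
Proof. by move=> e; rewrite !mxevalE e. Qed.

Lemma mxeval_vec (A : 'M[K]_N.+1) : mxeval A = (ones_row *m (A *m e0)) 0 0.
Proof. by rewrite /mxeval mulmxA. Qed.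

Lemma shift_trunc1 s : (0 < (last (0, 0)%N s).2)%N ->
  mxeval (lhs1 lam X Y s) - mxeval (rhs1 (lam - 1) X Y' s) = 0.
Proof.
rewrite /lhs1 /rhs1 opprB.
case: s => // a s ls; apply/eqP; rewrite subr_eq0; apply/eqP/mxeval_eq.
exact: esym (@trunc_case1 a s ls).
Qed.

Lemma shift_trunc2 q s : (0 < (last (0, q)%N s).2)%N ->
  mxeval (lhs2 lam X Y q s) - mxeval (rhs2 (lam - 1) X Y' q s)
  = (N.+1%:R - lam)^-1 * mxeval (Y ^+ q * Lprod C X Y s).
Proof.
rewrite /lhs2 /rhs2 -/C -/(mxD (lam - 1)).
move=> ls.
have hq : (0 < q)%N || (s != [::]) by case: s ls => [->|? ? _]; rewrite ?orbT.
rewrite !mxeval_vec [(Y ^+ q * _) *m _]mulmx_vec -(trunc_case2_aux hq (mxY_E0 ls) erefl).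
move: (Mprod _ _ _ _) (Lprod _ _ _ _) => M L.
rewrite [(_ * L) *m _]mulmx_vec [(_ * Y ^+ q) *m _]mulmx_vec; congr (_ - (_ *m _) 0 0).
rewrite -scalemxAl scalemxAr [LHS]mulmx_vec; congr (_ *m _).
rewrite /E0 mulmxBl mul1mx scalerDr scalerA -scalemxAl scaleNr; congr (_ + _).
rewrite -[LHS]scale1r; congr (_ *: _).
have := natr_sub_lam_neq0 0; move=> h; field; exact: h.
Qed.

Lemma shift_trunc3 s p : mxeval (lhs3 lam X Y s p) - mxeval (rhs3 (lam - 1) X Y' s p) = 0.
Proof.
rewrite /lhs3 /rhs3 -/C -/(mxD (lam - 1)).
apply/eqP; rewrite subr_eq0; apply/eqP/mxeval_eq; rewrite Lprod_rcons0.
case: s => [|a s]; first by rewrite -trunc_case3.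
by rewrite rcons_cons -trunc_case3 // last_rcons.
Qed.

Lemma shift_trunc4 q s p :
  mxeval (lhs4 lam X Y q s p) - mxeval (rhs4 (lam - 1) X Y' q s p)
  = (N.+1%:R - lam)^-1 * mxeval (Y ^+ q * Lprod C X Y (rcons s (p, 0)%N)).
Proof.
rewrite /lhs4 /rhs4 -/C -/(mxD (lam - 1)).
have hq : (0 < q)%N || (rcons s (p, 0)%N != [::]) by case: s => [|? ?]; rewrite orbT.
have hE : Y' ^+ (last (0, q)%N (rcons s (p, 0)%N)).2 *m (Y' *m e0)
  = Dn *m (Y ^+ (last (0, q)%N (rcons s (p, 0)%N)).2 *m e0).
  by rewrite last_rcons /= !expr0 !mul1mx mxDn_e0.
rewrite !mxeval_vec [(Y ^+ q * _) *m _]mulmx_vec -(trunc_case2_aux hq hE erefl).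
move: (Mprod _ _ _ _) => M; rewrite -Lprod_rcons0.
move: (Lprod _ _ _ _) => L; congr (_ - _); last by rewrite -!scalemxAl [(X * M * Y') *m _]mulmx_vec.
by rewrite -!mulmx_vec !mulrA.
Qed.
End Truncated.

(** * Expanding the sums over families *)

Lemma big_Forall_eq (T : Type) (V : nmodType) (r : seq T) (F G : T -> V) :
  List.Forall (fun i => F i = G i) r -> \sum_(i <- r) F i = \sum_(i <- r) G i.
Proof. by elim=> [|i s e _ IH]; rewrite ?big_nil // !big_cons e IH. Qed.

Lemma big01_eq (V : nmodType) (F G : nat -> V) : (forall d, (d <= 1)%N -> F d = G d) ->
  \sum_(d <- [:: 0; 1]%N) F d = \sum_(d <- [:: 0; 1]%N) G d.
Proof. by move=> h; apply: eq_big_seq => d; rewrite !inE => /orP[] /eqP ->; exact: h. Qed.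

(* Families are functions on nat, not an eqType, hence List.Forall instead of {in _}. *)
Lemma families_Forall S lo n :
  List.Forall (fun p => forall i, (lo <= i < lo + n)%N -> p i \in S) (families S lo n).
Proof.
elim: n lo => [|n IH] lo /=.
  by constructor => // i; rewrite addn0 => /andP[h1 h2]; move: (leq_ltn_trans h1 h2); rewrite ltnn.
suff : forall S', {subset S' <= S} -> List.Forall (fun p => forall i, (lo <= i < lo + n.+1)%N -> p i \in S)
    (flatten [seq [seq (fun i => if i == lo then a else g i) | g <- families S lo.+1 n] | a <- S']).
  by apply.
elim=> [|a S' IH'] hS /=; first by constructor.
apply/List.Forall_app; split; last by apply: IH' => b hb; apply: hS; rewrite inE hb orbT.
elim: (IH lo.+1) => [|p r hp _ IHr] /=; constructor => // i hi.
case: eqP => [_|ne]; first by apply: hS; rewrite inE eqxx.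
apply: hp; lia.
Qed.

Lemma iotaS_cons lo n : iota lo n.+1 = lo :: iota lo.+1 n.
Proof. by []. Qed.

Section Expansion.
Variables (K : fieldType) (A : algType K).

Lemma xword_xyword (x y : A) kl :
  xword x y (xyword kl) = \prod_(p <- kl) (x ^+ p.1 * y ^+ p.2).
Proof.
rewrite /xword /xyword; elim: kl => [|[a b] kl IH] /=; first by rewrite !big_nil.
rewrite big_cat IH big_cons /= big_cat /=; congr (_ * _).
have e c n : \prod_(b <- nseq n c) (if b then x else y) = (if c then x else y) ^+ n.
  by elim: n => [|n IHn]; rewrite ?big_nil // big_cons IHn exprS.
by rewrite !e.
Qed.

(** Distributivity: the sum over families of products is a product over the indices of sums over
    [S], with the power of t shared out among the indices. *)
Lemma families_expand (t : K) (S : seq (nat * nat)) (W : nat -> nat * nat -> A) lo n :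
  \sum_(p <- families S lo n)
     t ^+ (\sum_(i <- iota lo n) (1 - (p i).1 - (p i).2)) *: \prod_(i <- iota lo n) W i (p i)
  = \prod_(i <- iota lo n) \sum_(a <- S) t ^+ (1 - a.1 - a.2) *: W i a.
Proof.
elim: n lo => [|n IH] lo /=; first by rewrite big_seq1 !big_nil expr0 scale1r.
rewrite big_flatten big_map big_cons -IH mulr_suml; apply: eq_bigr => a _.
rewrite big_map mulr_sumr; apply: eq_bigr => p _.
rewrite !big_cons eqxx exprD -scalerAl -scalerAr scalerA.
have ne i : i \in iota lo.+1 n -> (i == lo) = false by rewrite mem_iota; lia.
congr (_ * _ ^+ _ *: (_ * _)).
  by apply: eq_big_seq => i /ne ->.
by apply: eq_big_seq => i /ne ->.
Qed.

Variables (lam : K) (x y : A) (k l : nat -> nat).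

(** At the corner, (0,0) keeps xy with coefficient -lam, (1,0) leaves y and (0,1) leaves x. *)
Lemma sum_Iset_L i : (0 < k i)%N -> (0 < l i)%N ->
  \sum_(a <- Iset) (- lam) ^+ (1 - a.1 - a.2) *: (x ^+ (k i - a.1) * y ^+ (l i - a.2))
  = x ^+ (k i).-1 * cornerC lam x y * y ^+ (l i).-1.
Proof.
case: (k i) (l i) => // a [] // b _ _.
rewrite !big_cons big_nil /= !(expr0, expr1, scale1r, subn0, subn1, addr0) /=.
rewrite /cornerC mulrDr mulrDl mulrDr mulrDl !mulrN mulNr scaleNr [RHS]addrC.
rewrite -!scalerAr -scalerAl; congr (- (_ *: _) + _).
  by rewrite !mulrA -exprSr -!mulrA -exprS.
by rewrite addrC -!mulrA -exprS !mulrA -exprSr.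
Qed.

Lemma sum_Iset_M i j : (0 < k i)%N -> (0 < l j)%N ->
  \sum_(a <- Iset) (- lam) ^+ (1 - a.1 - a.2) *: (y ^+ (l j - a.2) * x ^+ (k i - a.1))
  = y ^+ (l j).-1 * cornerD lam x y * x ^+ (k i).-1.
Proof.
case: (k i) (l j) => // a [] // b _ _.
rewrite !big_cons big_nil /= !(expr0, expr1, scale1r, subn0, subn1, addr0) /=.
rewrite /cornerD mulrDr mulrDl mulrDr mulrDl !mulrN mulNr scaleNr [RHS]addrC.
rewrite -!scalerAr -scalerAl; congr (- (_ *: _) + _).
  by rewrite !mulrA -exprSr -!mulrA -exprS.
by rewrite addrC -!mulrA -exprS !mulrA -exprSr.
Qed.

(* Cutting the word between y and x instead of between x and y: y^{l_{j-1}} x^{k_j} is indexed by j. *)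
Lemma prod_regroup (a b : nat -> nat) lo n :
  \prod_(i <- iota lo n.+1) (x ^+ a i * y ^+ b i)
  = x ^+ a lo * (\prod_(j <- iota lo.+1 n) (y ^+ b j.-1 * x ^+ a j)) * y ^+ b (lo + n)%N.
Proof.
elim: n lo => [|n IH] lo; first by rewrite /= big_seq1 big_nil mulr1 addn0.
by rewrite [iota lo _]iotaS_cons big_cons IH addSnnS [iota lo.+1 n.+1]iotaS_cons big_cons !mulrA.
Qed.

Lemma Mprod_regroup (d : A) (a b : nat -> nat) lo n :
  Mprod d x y [seq (a i, b i) | i <- iota lo n.+1]
  = x ^+ a lo * (\prod_(j <- iota lo.+1 n) (y ^+ b j.-1 * d * x ^+ a j)) * y ^+ b (lo + n)%N.
Proof.
elim: n lo => [|n IH] lo; first by rewrite /= big_nil !mulr1 addn0.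
transitivity (x ^+ a lo * y ^+ b lo * (d * Mprod d x y [seq (a i, b i) | i <- iota lo.+1 n.+1])) => //.
by rewrite IH addSnnS [in RHS]iotaS_cons big_cons !mulrA.
Qed.

Lemma expz_nat (t : K) (a b c w : nat) : (w + b + c = a)%N ->
  t ^ (a%:Z - b%:Z - c%:Z) = t ^+ w.
Proof. by move=> e; rewrite exprnP; congr (_ ^ _); lia. Qed.

(** On [Iset] the truncated difference 1 - a.1 - a.2 is exact, as at most one coordinate is 1. This
    matches the integer exponents of the theorem with the natural ones of [families_expand]. *)
Lemma Iset_count (p : nat -> nat * nat) lo n :
  (forall i, (lo <= i < lo + n)%N -> p i \in Iset) ->
  (\sum_(i <- iota lo n) (1 - (p i).1 - (p i).2) + \sum_(i <- iota lo n) (p i).1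
   + \sum_(i <- iota lo n) (p i).2 = n)%N.
Proof.
elim: n lo => [|n IH] lo hp /=; first by rewrite !big_nil.
have /IH IH' : forall i, (lo.+1 <= i < lo.+1 + n)%N -> p i \in Iset.
  by move=> i hi; apply: hp; lia.
have : p lo \in Iset by apply: hp; lia.
by rewrite !big_cons !inE => /or3P[] /eqP -> /=; lia.
Qed.

Definition pred_pairs lo n := [seq ((k i).-1, (l i).-1) | i <- iota lo n].

Lemma families_L lo n :
  (forall i, (lo <= i < lo + n)%N -> (0 < k i)%N /\ (0 < l i)%N) ->
  \sum_(p <- families Iset lo n)
     (- lam) ^+ (\sum_(i <- iota lo n) (1 - (p i).1 - (p i).2)) *:
     xword x y (xyword [seq (k i - (p i).1, l i - (p i).2)%N | i <- iota lo n])
  = Lprod (cornerC lam x y) x y (pred_pairs lo n).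
Proof.
move=> hkl; under eq_bigr => p _ do rewrite xword_xyword big_map /=.
rewrite (families_expand (- lam) Iset (fun i a => x ^+ (k i - a.1) * y ^+ (l i - a.2))).
rewrite /Lprod big_map; apply: eq_big_seq => i; rewrite mem_iota => /hkl [hk hl].
exact: sum_Iset_L.
Qed.

Definition Mid lo n :=
  \prod_(j <- iota lo n) (y ^+ (l j.-1).-1 * cornerD lam x y * x ^+ (k j).-1).

Lemma families_M lo n :
  (forall j, (lo <= j < lo + n)%N -> (0 < k j)%N /\ (0 < l j.-1)%N) ->
  \sum_(q <- families Iset lo n)
     (- lam) ^+ (\sum_(i <- iota lo n) (1 - (q i).1 - (q i).2)) *:
     \prod_(j <- iota lo n) (y ^+ (l j.-1 - (q j).2) * x ^+ (k j - (q j).1))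
  = Mid lo n.
Proof.
move=> hkl.
rewrite (families_expand (- lam) Iset (fun j a => y ^+ (l j.-1 - a.2) * x ^+ (k j - a.1))).
rewrite /Mid; apply: eq_big_seq => i; rewrite mem_iota => /hkl [hk hl].
exact: sum_Iset_M.
Qed.

Variable m : nat.
Hypothesis m_gt0 : (0 < m)%N.
Hypothesis kl_gt0 : forall i, (1 <= i <= m)%N -> (1 <= k i)%N /\ (1 <= l i)%N.

(** The entry q j acts on the corner between y^{l_{j-1}} and x^{k_j}, so block i involves both q i
    and q (i+1); d and e are delta'_1 and epsilon'_{m+1}, acting at the two ends of the word. *)
Definition shifted_pairs (d : nat) (q : nat -> nat * nat) (e : nat) :=
  [seq (k i - (if i == 1 then d else (q i).1), l i - (if i == m then e else (q i.+1).2))%N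
  | i <- iota 1 m].

Lemma xword_shifted_pairs d q e :
  xword x y (xyword (shifted_pairs d q e))
  = x ^+ (k 1 - d) * (\prod_(j <- iota 2 m.-1) (y ^+ (l j.-1 - (q j).2) * x ^+ (k j - (q j).1)))
    * y ^+ (l m - e).
Proof.
rewrite xword_xyword big_map /=.
have -> : iota 1 m = iota 1 m.-1.+1 by rewrite prednK.
rewrite (prod_regroup (fun i => k i - (if i == 1 then d else (q i).1))%N
  (fun i => l i - (if i == m then e else (q i.+1).2))%N) eqxx add1n prednK // eqxx.
congr (_ * _ * _); apply: eq_big_seq => j; rewrite mem_iota => hj.
have -> : (j.-1 == m) = false by lia.
have -> : (j == 1)%N = false by lia.
by rewrite prednK //; lia.
Qed.

(** The m - 1 inner corners absorb their share of the exponent and leave 1 - d - e. This is -1 for d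
    = e = 1, whence the integer power and the nonzero base. *)
Lemma families_shifted (d e : nat) : (d <= 1)%N -> (e <= 1)%N -> - lam != 0 ->
  \sum_(q <- families Iset 2 m.-1)
    (- lam) ^ (m%:Z - (d + \sum_(2 <= j < m.+1) (q j).1)%N%:Z
                    - (\sum_(2 <= j < m.+1) (q j).2 + e)%N%:Z)
    *: xword x y (xyword (shifted_pairs d q e))
  = (- lam) ^ (1 - d%:Z - e%:Z) *: (x ^+ (k 1 - d) * Mid 2 m.-1 * y ^+ (l m - e)).
Proof.
move=> d1 e1 t0.
rewrite -families_M; last by move=> j hj; split; [apply: (kl_gt0 _).1|apply: (kl_gt0 _).2]; lia.
rewrite mulr_sumr mulr_suml scaler_sumr; apply: big_Forall_eq.
apply: List.Forall_impl (families_Forall Iset 2 m.-1) => q hq.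
rewrite xword_shifted_pairs -scalerAr -scalerAl scalerA; congr (_ *: _).
rewrite [LHS](_ : _ = (- lam) ^ ((1 - d%:Z - e%:Z)
  + (\sum_(i <- iota 2 m.-1) (1 - (q i).1 - (q i).2))%N%:Z)); first by rewrite expfzDr // exprnP.
congr (_ ^ _); have := Iset_count hq; rewrite /index_iota (_ : m.+1 - 2 = m.-1)%N; last lia.
  by move: (\sum_(i <- _) (1 - _ - _))%N (\sum_(i <- _) _.1)%N (\sum_(i <- _) _.2)%N => a b c; lia.
Qed.

Lemma Mprod_pred_pairs :
  Mprod (cornerD lam x y) x y (pred_pairs 1 m) = x ^+ (k 1).-1 * Mid 2 m.-1 * y ^+ (l m).-1.
Proof.
rewrite /pred_pairs; have -> : iota 1 m = iota 1 m.-1.+1 by rewrite prednK.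
by rewrite (Mprod_regroup _ (fun i => (k i).-1) (fun i => (l i).-1)) add1n prednK.
Qed.

Lemma sum01 i : (0 < k i)%N ->
  \sum_(d <- [:: 0; 1]%N) (- lam) ^+ (1 - d) *: x ^+ (k i - d) = (1 - lam *: x) * x ^+ (k i).-1.
Proof.
case: (k i) => // a _; rewrite big_cons big_seq1 /= !subn0 !subn1 expr1 expr0 scale1r /=.
by rewrite mulrBl mul1r -scalerAl -exprS scaleNr addrC.
Qed.

End Expansion.

(** * The sums of the theorem and their closed forms *)

Section Sums.
Variables (K : fieldType) (V : lmodType K) (t : K) (m : nat) (k l : nat -> nat)
  (G : seq (nat * nat) -> V).

(** The module [V] and the function [G] are left open so that the same sums can be formed of
    matrices at level N and of limit values. *)
Definition sumL1 : V := \sum_(p <- families Iset 1 m)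
  t ^ (m%:Z - (\sum_(1 <= i < m.+1) (p i).1)%N%:Z - (\sum_(1 <= i < m.+1) (p i).2)%N%:Z)
  *: G [seq (k i - (p i).1, l i - (p i).2)%N | i <- iota 1 m].

Definition sumL2 : V := \sum_(e1 <- [:: 0; 1]%N) \sum_(p <- families Iset 2 m.-1)
  t ^ (m%:Z - (\sum_(2 <= i < m.+1) (p i).1)%N%:Z - (e1 + \sum_(2 <= i < m.+1) (p i).2)%N%:Z)
  *: G ((1, l 1 - e1)%N :: [seq (k i - (p i).1, l i - (p i).2)%N | i <- iota 2 m.-1]).

Definition sumL3 : V := \sum_(p <- families Iset 1 m.-1) \sum_(dm <- [:: 0; 1]%N)
  t ^ (m%:Z - (\sum_(1 <= i < m) (p i).1 + dm)%N%:Z - (\sum_(1 <= i < m) (p i).2)%N%:Z)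
  *: G ([seq (k i - (p i).1, l i - (p i).2)%N | i <- iota 1 m.-1] ++ [:: (k m - dm, 1)%N]).

Definition sumL4 : V := \sum_(e1 <- [:: 0; 1]%N) \sum_(p <- families Iset 2 (m - 2))
    \sum_(dm <- [:: 0; 1]%N)
  t ^ (m%:Z - (\sum_(2 <= i < m) (p i).1 + dm)%N%:Z - (e1 + \sum_(2 <= i < m) (p i).2)%N%:Z)
  *: G ((1, l 1 - e1)%N :: [seq (k i - (p i).1, l i - (p i).2)%N | i <- iota 2 (m - 2)]
        ++ [:: (k m - dm, 1)%N]).

(* The four right-hand sides: [ds] is [:: 0] when k_1 = 1 and [es] is [:: 0] when l_m = 1. *)
Definition sumR (ds es : seq nat) : V :=
  \sum_(d <- ds) \sum_(q <- families Iset 2 m.-1) \sum_(e <- es)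
  t ^ (m%:Z - (d + \sum_(2 <= j < m.+1) (q j).1)%N%:Z
            - (\sum_(2 <= j < m.+1) (q j).2 + e)%N%:Z)
  *: G (shifted_pairs k l m d q e).
End Sums.

Section SumForms.
Variables (K : fieldType) (A : algType K) (lam : K) (x y : A) (m : nat) (k l : nat -> nat).
Hypothesis m_gt0 : (0 < m)%N.
Hypothesis kl_gt0 : forall i, (1 <= i <= m)%N -> (1 <= k i)%N /\ (1 <= l i)%N.
Let G kl := xword x y (xyword kl).

Lemma sumL1_form : sumL1 (- lam) m k l G = lhs1 lam x y (pred_pairs k l 1 m).
Proof.
rewrite /lhs1 -families_L; last by move=> i hi; apply: kl_gt0; lia.
apply: big_Forall_eq; apply: List.Forall_impl (families_Forall Iset 1 m) => p hp.
congr (_ *: _); apply: expz_nat; rewrite /index_iota subSS subn0; exact: Iset_count.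
Qed.

Lemma sumL2_form : k 1 = 1%N ->
  sumL2 (- lam) m k l G = lhs2 lam x y (l 1).-1 (pred_pairs k l 2 m.-1).
Proof.
move=> k1; rewrite /lhs2 -families_L; last by move=> i hi; apply: kl_gt0; lia.
rewrite -[x * _ * _]mulrA -(sum01 lam y); last by apply: (kl_gt0 _).2; lia.
rewrite [x * \sum_(e <- _) _]mulr_sumr mulr_suml /sumL2; apply: big01_eq => d d1.
rewrite mulr_sumr; apply: big_Forall_eq.
apply: List.Forall_impl (families_Forall Iset 2 m.-1) => p hp.
rewrite -!scalerAr -scalerAl scalerA -exprD; congr (_ *: _).
  apply: expz_nat; have := Iset_count hp; rewrite /index_iota (_ : m.+1 - 2 = m.-1)%N; last lia.
  by move: (\sum_(i <- _) (1 - _ - _))%N (\sum_(i <- _) _.1)%N (\sum_(i <- _) _.2)%N => a b c; lia.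
by rewrite /G !xword_xyword big_cons /= expr1.
Qed.

Lemma sumL3_form : l m = 1%N ->
  sumL3 (- lam) m k l G = lhs3 lam x y (pred_pairs k l 1 m.-1) (k m).-1.
Proof.
move=> lm; rewrite /lhs3 -families_L; last by move=> i hi; apply: kl_gt0; lia.
rewrite -mulrA [x ^+ _ * _]mulrA.
have -> : x ^+ (k m).-1 * (1 - lam *: x) = (1 - lam *: x) * x ^+ (k m).-1.
  by rewrite mulrBr mulrBl mulr1 mul1r -scalerAr -scalerAl -exprS -exprSr.
rewrite -(sum01 lam x); last by apply: (kl_gt0 _).1; lia.
rewrite mulr_suml; apply: big_Forall_eq.
apply: List.Forall_impl (families_Forall Iset 1 m.-1) => p hp.
rewrite mulr_suml mulr_sumr; apply: big01_eq => d d1.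
rewrite -!scalerAl -scalerAr scalerA -exprD; congr (_ *: _).
  apply: expz_nat; have := Iset_count hp; rewrite /index_iota subn1; lia.
by rewrite /G !xword_xyword big_cat big_seq1 /= expr1.
Qed.

Lemma sumL4_form : (2 <= m)%N -> k 1 = 1%N -> l m = 1%N ->
  sumL4 (- lam) m k l G = lhs4 lam x y (l 1).-1 (pred_pairs k l 2 (m - 2)) (k m).-1.
Proof.
move=> m2 k1 lm; rewrite /lhs4 -families_L; last by move=> i hi; apply: kl_gt0; lia.
rewrite -[_ * x ^+ _ * _]mulrA [x ^+ _ * (_ * y)]mulrA.
have -> : x ^+ (k m).-1 * (1 - lam *: x) = (1 - lam *: x) * x ^+ (k m).-1.
  by rewrite mulrBr mulrBl mulr1 mul1r -scalerAr -scalerAl -exprS -exprSr.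
rewrite -[x * (1 - _) * y ^+ _]mulrA -(sum01 lam y); last by apply: (kl_gt0 _).2; lia.
rewrite -(sum01 lam x); last by apply: (kl_gt0 _).1; lia.
rewrite [x * \sum_(e <- _) _]mulr_sumr !mulr_suml /sumL4; apply: big01_eq => d d1.
rewrite [_ * \sum_(p <- families _ _ _) _]mulr_sumr mulr_suml; apply: big_Forall_eq.
apply: List.Forall_impl (families_Forall Iset 2 (m - 2)) => p hp.
rewrite mulr_sumr; apply: big01_eq => e e1.
rewrite -!(scalerAr, scalerAl) !scalerA -!exprD; congr (_ *: _).
  apply: expz_nat; have := Iset_count hp; rewrite /index_iota; lia.
by rewrite /G !xword_xyword big_cons big_cat big_seq1 /= expr1 !mulrA.
Qed.

Hypothesis lam0 : - lam != 0.

Lemma sumRE ds es : all (leq^~ 1)%N ds -> all (leq^~ 1)%N es ->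
  sumR (- lam) m k l G ds es = \sum_(d <- ds) \sum_(e <- es)
    (- lam) ^ (1 - d%:Z - e%:Z) *: (x ^+ (k 1 - d) * Mid lam x y k l 2 m.-1 * y ^+ (l m - e)).
Proof.
move=> /allP hd /allP he; apply: eq_big_seq => d /hd d1.
rewrite exchange_big; apply: eq_big_seq => e /he e1; exact: families_shifted.
Qed.

(** Splitting 1 - d - e as -1 + (1 - d) + (1 - e) separates the two ends. An end with the list
    [0, 1] yields a factor 1 - lam x or 1 - lam y; an end with the list [0] yields a scalar -lam,
    which explains the prefactors of [rhs1] to [rhs4]. *)
Lemma sumR_factor ds es : all (leq^~ 1)%N ds -> all (leq^~ 1)%N es ->
  sumR (- lam) m k l G ds es = (- lam)^-1 *:
    ((\sum_(d <- ds) (- lam) ^+ (1 - d) *: x ^+ (k 1 - d)) * Mid lam x y k l 2 m.-1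
     * (\sum_(e <- es) (- lam) ^+ (1 - e) *: y ^+ (l m - e))).
Proof.
move=> hd he; rewrite sumRE // !mulr_suml scaler_sumr; apply: eq_big_seq => d /(allP hd) d1.
rewrite mulr_sumr scaler_sumr; apply: eq_big_seq => e /(allP he) e1.
rewrite -!(scalerAr, scalerAl) !scalerA; congr (_ *: _).
rewrite [1 - d%:Z - e%:Z](_ : _ = -1 + (1 - d)%N%:Z + (1 - e)%N%:Z); last by lia.
by rewrite !expfzDr // exprN1 mulrAC.
Qed.

Lemma pred_pairs_cons : pred_pairs k l 1 m = ((k 1).-1, (l 1).-1) :: pred_pairs k l 2 m.-1.
Proof. by rewrite /pred_pairs -[in LHS](prednK m_gt0). Qed.

Lemma pred_pairs_rcons lo n : pred_pairs k l lo n.+1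
  = rcons (pred_pairs k l lo n) ((k (lo + n)%N).-1, (l (lo + n)%N).-1).
Proof. by rewrite /pred_pairs -addn1 iotaD map_cat cats1. Qed.

Lemma comm_1sub (z : A) n : z ^+ n * (1 - lam *: z) = (1 - lam *: z) * z ^+ n.
Proof. by rewrite mulrBr mulrBl mulr1 mul1r -scalerAr -scalerAl -exprS -exprSr. Qed.

Lemma sumR1_form :
  sumR (- lam) m k l G [:: 0; 1]%N [:: 0; 1]%N = rhs1 lam x y (pred_pairs k l 1 m).
Proof.
have [k1 _] := kl_gt0 (introT andP (conj (leqnn 1) m_gt0)).
have [_ lm] := kl_gt0 (introT andP (conj m_gt0 (leqnn m))).
rewrite sumR_factor // (sum01 lam x k1) (sum01 lam y lm) /rhs1 Mprod_pred_pairs //.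
by rewrite -!mulrA comm_1sub.
Qed.

Lemma sumR2_form : k 1 = 1%N ->
  sumR (- lam) m k l G [:: 0]%N [:: 0; 1]%N = rhs2 lam x y (l 1).-1 (pred_pairs k l 2 m.-1).
Proof.
move=> k1; have [_ lm] := kl_gt0 (introT andP (conj m_gt0 (leqnn m))).
have -> : rhs2 lam x y (l 1).-1 (pred_pairs k l 2 m.-1)
  = x * Mprod (cornerD lam x y) x y (pred_pairs k l 1 m) * (1 - lam *: y).
  by rewrite pred_pairs_cons k1.
rewrite sumR_factor // (sum01 lam y lm) Mprod_pred_pairs // big_seq1 subn0 k1 expr1 /=.
by rewrite -comm_1sub -!scalerAl scalerA mulVf // scale1r subn0 expr0 mul1r !mulrA.
Qed.

Lemma sumR3_form : l m = 1%N ->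
  sumR (- lam) m k l G [:: 0; 1]%N [:: 0]%N = rhs3 lam x y (pred_pairs k l 1 m.-1) (k m).-1.
Proof.
move=> lm; have [k1 _] := kl_gt0 (introT andP (conj (leqnn 1) m_gt0)).
have -> : rhs3 lam x y (pred_pairs k l 1 m.-1) (k m).-1
  = (1 - lam *: x) * Mprod (cornerD lam x y) x y (pred_pairs k l 1 m) * y.
  by rewrite -[in RHS](prednK m_gt0) pred_pairs_rcons add1n prednK // lm.
rewrite sumR_factor // (sum01 lam x k1) Mprod_pred_pairs // big_seq1 subn0 lm expr1 /=.
by rewrite -scalerAr scalerA mulVf // scale1r expr0 mulr1 subn0 !mulrA.
Qed.

Lemma sumR4_form : (2 <= m)%N -> k 1 = 1%N -> l m = 1%N ->
  sumR (- lam) m k l G [:: 0]%N [:: 0]%N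
  = rhs4 lam x y (l 1).-1 (pred_pairs k l 2 (m - 2)) (k m).-1.
Proof.
move=> m2 k1 lm.
have -> : rhs4 lam x y (l 1).-1 (pred_pairs k l 2 (m - 2)) (k m).-1
  = - lam *: (x * Mprod (cornerD lam x y) x y (pred_pairs k l 1 m) * y).
  rewrite pred_pairs_cons k1 (_ : m.-1 = (m - 2).+1); last by lia.
  by rewrite pred_pairs_rcons (_ : (2 + (m - 2) = m)%N) ?lm //; lia.
rewrite sumR_factor // Mprod_pred_pairs // !big_seq1 !subn0 k1 lm !expr1 /=.
by rewrite -scalerAr -!scalerAl !scalerA mulVf // mul1r !expr0 mul1r mulr1.
Qed.
End SumForms.

(** * Growth bounds and convergence *)

Local Open Scope complex_scope.
Local Open Scope classical_set_scope.

Lemma normcS (R : rcfType) (n : nat) (F : nat -> R[i]) :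
  normc (\sum_(0 <= i < n) F i) <= \sum_(0 <= i < n) normc (F i).
Proof.
elim: n => [|n IH]; first by rewrite !big_nil normc0.
by rewrite !big_nat_recr //=; apply: (le_trans (le_normcD _ _)); rewrite lerD2r.
Qed.

Lemma normc_ge0 (R : rcfType) (z : R[i]) : 0 <= normc z.
Proof. by case: z => a b; exact: sqrtr_ge0. Qed.

Lemma ge_normc_Re (R : rcfType) (z : R[i]) : `|complex.Re z| <= normc z.
Proof. by rewrite -lecR normc_ge_Re. Qed.

Lemma ge_normc_Im (R : rcfType) (z : R[i]) : `|complex.Im z| <= normc z.
Proof.
rewrite -normrN -ReiNIm; apply: le_trans (ge_normc_Re _) _.
by rewrite normcM [normc 'i%C]/= expr0n /= add0r expr1n sqrtr1 mulr1.
Qed.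

Lemma normc_nat (R : rcfType) n : normc (n%:R : R[i]) = n%:R.
Proof. by apply: complexI; rewrite rmorph_nat -[RHS]normr_nat. Qed.

Lemma normc_natV (R : rcfType) n : normc ((n%:R : R[i])^-1) = n%:R^-1.
Proof. by rewrite normcV normc_nat. Qed.

Lemma sum_sqrtV_le (R : rcfType) n :
  \sum_(0 <= i < n) (Num.sqrt i.+1%:R)^-1 <= 2 * Num.sqrt n%:R :> R.
Proof.
elim: n => [|n IH]; first by rewrite big_nil sqrtr0 mulr0.
rewrite big_nat_recr //=; apply: (le_trans (lerD IH (lexx _))).
have a2 : Num.sqrt n%:R ^+ 2 = n%:R :> R by rewrite sqr_sqrtr.
have b2 : Num.sqrt n.+1%:R ^+ 2 = n%:R + 1 :> R by rewrite sqr_sqrtr // natr1.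
have b0 : 0 < Num.sqrt n.+1%:R :> R by rewrite sqrtr_gt0.
move: (Num.sqrt n%:R) (Num.sqrt n.+1%:R) a2 b2 b0 => a b a2 b2 b0.
(* Multiplied by b, the claim 2a + 1/b <= 2b becomes 2ab <= a^2 + b^2, because b^2 = a^2 + 1. *)
rewrite -(ler_pM2r b0) mulrDl mulVf ?gt_eqF //; nra.
Qed.

Lemma sqrt_mul_le (R : realFieldType) (a b t : R) : a ^+ 2 = t -> b ^+ 2 = t + 1 ->
  0 < a -> 0 < b -> 1 <= t -> a * b <= 2 * t.
Proof. by nra. Qed.

(** A telescoping bound for terms of size t^{-3/2}. It reduces to 1 <= 3a(b - a) = 3a/(a + b), which
    holds because b <= 2a for t >= 1; this is the origin of the constant 3. *)
Lemma sqrt_diff_ge (R : realFieldType) (a b t c : R) : a ^+ 2 = t -> b ^+ 2 = t + 1 ->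
  0 < a -> 0 < b -> 1 <= t -> 0 <= c -> t^-1 * (c / b) <= 3 * c / a - 3 * c / b.
Proof.
move=> <- b2 a0 b0 j1 c0.
have -> : a ^- 2 * (c / b) = c * (a ^- 2 / b) by ring.
have -> : 3 * c / a - 3 * c / b = c * (3 * (b - a) / (a * b)).
  by field; rewrite !gt_eqF.
apply: ler_wpM2l => //.
have -> : a ^- 2 / b = a^-1 / (a * b) by field; rewrite !gt_eqF.
rewrite ler_pM2r ?invr_gt0 ?mulr_gt0 // -(ler_pM2r a0) mulVf ?gt_eqF //.
have ab : a < b by nra.
nra.
Qed.

Section Bounds.
Variables (R : realType) (lam : R[i]).
Hypothesis lamP : forall n : nat, lam != n.+1%:R.
Local Notation K := R[i].

(** Once n+1 >= 2|lam| the constant 2 suffices; the finitely many earlier indices are covered by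
    adding their values to the constant. *)
Lemma normc_sub_lamV : exists2 c : R, 0 <= c &
  forall n : nat, normc ((n.+1%:R - lam)^-1) <= c / n.+1%:R.
Proof.
pose b n := normc ((n.+1%:R - lam)^-1) * n.+1%:R.
have b0 n : 0 <= b n by rewrite mulr_ge0 // normc_ge0.
pose M := Num.bound (2 * normc lam).
exists (2 + \sum_(0 <= i < M) b i) => [|n]; first by rewrite addr_ge0 // sumr_ge0.
rewrite ler_pdivlMr // -/(b n).
case: (ltnP n M) => [nM|Mn].
  rewrite big_mkord (bigD1 (Ordinal nM)) //= addrCA lerDl addr_ge0 // sumr_ge0 //.
apply: (@le_trans _ _ 2); last by rewrite lerDl sumr_ge0.
have hM : 2 * normc lam <= n.+1%:R.
  apply: le_trans (_ : M%:R <= _); last by rewrite ler_nat ltnW.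
  by apply/ltW/archi_boundP; rewrite mulr_ge0 // normc_ge0.
have h1 : n.+1%:R <= normc (n.+1%:R - lam) + normc lam.
  have := le_normcD (n.+1%:R - lam) lam; rewrite subrK.
  by rewrite -[X in X <= _](invrK) -normcV normc_natV invrK.
have h0 : 0 < normc (n.+1%:R - lam).
  rewrite lt_def normc_ge0 andbT; apply/eqP => /eq0_normc /eqP; apply/negP.
  by rewrite subr_eq0 eq_sym.
rewrite /b normcV ler_pdivrMl //; lra.
Qed.

(** The letters acting on functions on all of [nat]; [mxX] and [mxY] are their truncations to
    0..N. *)
Definition opX (f : nat -> K) (j : nat) : K := j%:R^-1 * f j.
Definition opY (f : nat -> K) (j : nat) : K := (j%:R - lam)^-1 * \sum_(0 <= i < j) f i.

(* The bound (j+1)^{-1/2} is stable under both letters, which avoids tracking powers of log j. *)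
Definition sqrt_bounded (f : nat -> K) :=
  exists2 c : R, 0 <= c & forall j, normc (f j) <= c / Num.sqrt j.+1%:R.

Lemma sqrt_bounded_sum f : sqrt_bounded f ->
  exists2 c : R, 0 <= c & forall n, normc (\sum_(0 <= i < n) f i) <= c * Num.sqrt n%:R.
Proof.
move=> [c c0 hc]; exists (c * 2) => [|n]; first exact: mulr_ge0.
apply: le_trans (normcS _ _) _; rewrite -mulrA.
apply: le_trans (ler_wpM2l c0 (sum_sqrtV_le R n)).
by rewrite mulr_sumr; apply: ler_sum => i _.
Qed.

Lemma sqrt_bounded_e0 : sqrt_bounded (fun j => (j == 0)%N%:R).
Proof.
exists 1 => // j; rewrite normc_nat; case: j => [|j] /=.
  by rewrite sqrtr1 invr1 mulr1.
by rewrite mul1r invr_ge0 sqrtr_ge0.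
Qed.

Lemma sqrt_bounded_add f g a : sqrt_bounded f -> sqrt_bounded g ->
  sqrt_bounded (fun j => f j + a * g j).
Proof.
move=> [c c0 hc] [d d0 hd]; exists (c + normc a * d) => [|j].
  by rewrite addr_ge0 // mulr_ge0 // normc_ge0.
apply: (le_trans (le_normcD _ _)); rewrite normcM mulrDl; apply: lerD => //.
by rewrite -mulrA ler_wpM2l // normc_ge0.
Qed.

Lemma sqrt_bounded_opX f : sqrt_bounded f -> sqrt_bounded (opX f).
Proof.
move=> [c c0 hc]; exists c => // j; rewrite normcM normc_natV.
apply: le_trans (hc j); case: j => [|j]; first by rewrite invr0 mul0r normc_ge0.
by rewrite ler_piMl ?normc_ge0 // invf_le1 // ler1n.
Qed.

(** Summing terms O(j^{-1/2}) gives O(j^{1/2}), and the factor 1/(j - lam) = O(1/j) brings this back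
    to O(j^{-1/2}). *)
Lemma sqrt_bounded_opY f : sqrt_bounded f -> sqrt_bounded (opY f).
Proof.
move=> /sqrt_bounded_sum [c c0 hc]; have [d d0 hd] := normc_sub_lamV.
exists (d * (c * 2)) => [|j]; first by rewrite !mulr_ge0.
rewrite normcM; case: j => [|j].
  by rewrite big_nil normc0 mulr0 mulr_ge0 ?invr_ge0 ?sqrtr_ge0 ?mulr_ge0.
apply: le_trans (ler_pM (normc_ge0 _) (normc_ge0 _) (hd j) (hc _)) _.
have a2 : Num.sqrt j.+1%:R ^+ 2 = j.+1%:R :> R by rewrite sqr_sqrtr.
have b2 : Num.sqrt j.+2%:R ^+ 2 = j.+1%:R + 1 :> R by rewrite sqr_sqrtr // natr1.
have a0 : 0 < Num.sqrt j.+1%:R :> R by rewrite sqrtr_gt0.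
have b0 : 0 < Num.sqrt j.+2%:R :> R by rewrite sqrtr_gt0.
have j1 : 1 <= j.+1%:R :> R by rewrite ler1n.
have key : Num.sqrt j.+1%:R / j.+1%:R <= 2 / Num.sqrt j.+2%:R :> R.
  rewrite ler_pdivrMr // mulrAC ler_pdivlMr //.
  exact: sqrt_mul_le a2 b2 a0 b0 j1.
have -> : d / j.+1%:R * (c * Num.sqrt j.+1%:R) = d * c * (Num.sqrt j.+1%:R / j.+1%:R) by ring.
have -> : d * (c * 2) / Num.sqrt j.+2%:R = d * c * (2 / Num.sqrt j.+2%:R) by ring.
by rewrite ler_wpM2l // mulr_ge0.
Qed.

End Bounds.

(** * Convergence of the partial sums *)

Section Convergence.
Variables (R : realType).
Local Notation K := R[i].

(** The sequence v decreases and is bounded below. So does r + v, with lower bound r 0 - v 0 because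
    r - v increases; hence r = (r + v) - v converges. *)
Lemma cvgr_telescope (r v : nat -> R) : (forall n, 0 <= v n) ->
  (forall n, `|r n.+1 - r n| <= v n - v n.+1) -> cvgn r.
Proof.
move=> v0 hr.
have dv n : v n.+1 <= v n by rewrite -subr_ge0; apply: le_trans (hr n).
have cv : cvgn v.
  apply: nonincreasing_is_cvgn; first by apply/nonincreasing_seqP.
  by exists 0 => _ [n _ <-].
have crv : cvgn (fun n => r n + v n).
  apply: nonincreasing_is_cvgn.
    by apply/nonincreasing_seqP => n; have := hr n; rewrite ler_norml; lra.
  exists (r 0%N - v 0%N) => _ [n _ <-] /=.
  have : r 0%N - v 0%N <= r n - v n.
    by elim: n => // n; have := hr n; rewrite ler_norml; lra.
  by have := v0 n; lra.
have -> : r = (fun n => (r n + v n) - v n) by apply/funext => n; rewrite addrK.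
exact: is_cvgB.
Qed.

Lemma cvg_complex (u : nat -> K) :
  cvgn (fun n => complex.Re (u n)) -> cvgn (fun n => complex.Im (u n)) ->
  cvg ((u : nat -> K^o) @ \oo).
Proof.
move=> /cvg_ex[a ha] /cvg_ex[b hb].
apply/cvg_ex; exists (a +i* b : K^o).
apply/cvgrPdist_lt => e e0.
(* A positive element of [R[i]] is real, so the estimate can be made in [R]. *)
have er : (complex.Re e)%:C = e by rewrite RRe_real // gtr0_real.
have e0' : 0 < complex.Re e by rewrite -ltcR er.
have e2 : 0 < complex.Re e / 2 by rewrite divr_gt0.
move/cvgrPdist_lt : ha => /(_ _ e2) ha; move/cvgrPdist_lt : hb => /(_ _ e2) hb.
near=> n.
have h1 : `|a - complex.Re (u n)| < complex.Re e / 2 by near: n.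
have h2 : `|b - complex.Im (u n)| < complex.Re e / 2 by near: n.
rewrite -er -[X in X < _]/((normc _)%:C) ltcR.
have -> : (a +i* b : K) - u n = (a - complex.Re (u n))%:C + (0 +i* (b - complex.Im (u n))).
  by case: (u n) => c d; apply/eqP; rewrite eq_complex /= addr0 add0r !eqxx.
apply: (le_lt_trans (le_normcD _ _)).
rewrite /= !expr0n /= addr0 add0r !sqrtr_sqr; lra.
Unshelve. all: by end_near.
Qed.

(** The leading x improves the terms to O(j^{-3/2}), and [sqrt_diff_ge] bounds them by differences
    of 3c/sqrt(n+1). *)
Lemma cvg_partial_sums (f : nat -> K) :
  sqrt_bounded f -> cvg (((fun N => \sum_(0 <= j < N.+1) opX f j) : nat -> K^o) @ \oo).
Proof.
move=> [c c0 hc].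
pose v n : R := 3 * c / Num.sqrt n.+1%:R.
have v0 n : 0 <= v n by rewrite divr_ge0 ?sqrtr_ge0 ?mulr_ge0.
have hv n : normc (opX f n.+1) <= v n - v n.+1.
  rewrite normcM normc_natV; apply: le_trans (ler_wpM2l _ (hc _)) _; rewrite ?invr_ge0 //.
  rewrite /v.
  have a2 : Num.sqrt n.+1%:R ^+ 2 = n.+1%:R :> R by rewrite sqr_sqrtr.
  have b2 : Num.sqrt n.+2%:R ^+ 2 = n.+1%:R + 1 :> R by rewrite sqr_sqrtr // natr1.
  have a0 : 0 < Num.sqrt n.+1%:R :> R by rewrite sqrtr_gt0.
  have b0 : 0 < Num.sqrt n.+2%:R :> R by rewrite sqrtr_gt0.
  have j1 : 1 <= n.+1%:R :> R by rewrite ler1n.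
  exact: sqrt_diff_ge a2 b2 a0 b0 j1 c0.
apply: cvg_complex; apply: (cvgr_telescope v0) => n.
  rewrite (big_nat_recr n.+1) //= raddfD /= addrAC subrr add0r.
  exact: le_trans (ge_normc_Re _) (hv n).
rewrite (big_nat_recr n.+1) //= raddfD /= addrAC subrr add0r.
exact: le_trans (ge_normc_Im _) (hv n).
Qed.

End Convergence.

(** * Words acting on functions, and the vanishing of the boundary term *)

Section Words.
Variables (R : realType) (lam : R[i]).
Local Notation K := R[i].

(** For a nonempty word ending in y, the value at j is the part of the sum with n_1 = j. It does not
    depend on N. *)
Fixpoint word_fun (w : seq bool) : nat -> K :=
  match w with
  | [::] => fun j => (j == 0)%N%:R
  | true :: w' => opX (word_fun w')
  | false :: w' => opY lam (word_fun w')
  end.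

Lemma mxX_col N (f : nat -> K) : mxX K N *m (\col_j f j) = \col_j opX f j.
Proof.
apply/matrixP => j i; rewrite !mxE (bigD1 j) //= !mxE eqxx mul1r big1 ?addr0 // => k kj.
by rewrite !mxE eq_sym (negbTE kj) !mul0r.
Qed.

Lemma mxY_col N (f : nat -> K) : mxY N lam *m (\col_j f j) = \col_j opY lam f j.
Proof.
apply/matrixP => j i; rewrite !mxE /opY mulr_sumr.
rewrite big_mkord (big_ord_widen N.+1 (fun k => (j%:R - lam)^-1 * f k)) ?(ltnW (ltn_ord j)) //.
rewrite [RHS]big_mkcond /=.
apply: eq_bigr => k _; rewrite !mxE; case: ifP => _; by rewrite ?mul1r ?mul0r.
Qed.

Lemma xword_col N w :
  xword (mxX K N) (mxY N lam) w *m e0 K N = \col_j word_fun w j.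
Proof.
elim: w => [|[] w IH].
- rewrite /xword big_nil mul1mx; apply/matrixP => j i; rewrite !mxE ord1 andbT.
  by rewrite -val_eqE.
- by rewrite /xword big_cons mulmx_vec -mxX_col -IH.
- by rewrite /xword big_cons mulmx_vec -mxY_col -IH.
Qed.

(** The accumulator c counts the letters x already read. Both statements go through one induction:
    reading x raises c in the first, reading y restarts the tail at c = 0, where the tail may be
    empty and the second is used. *)
Lemma Ftrunc_word_fun w c n : last false w = false ->
  (w != [::] -> Ftrunc (word_exps_aux w c) lam n
      = \sum_(1 <= j < n.+1) (j%:R ^+ c)^-1 * word_fun w j)
  /\ Ftrunc (word_exps w) lam n = \sum_(0 <= j < n.+1) word_fun w j.
Proof.
rewrite /word_exps; elim: w c n => [|b w IH] c n.
  move=> _; split => //=; rewrite big_nat_recl //= big1 ?addr0 // => i _.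
move=> lw; have lw' : last false w = false by case: b lw; case: (w).
have key c' n' : Ftrunc (word_exps_aux (b :: w) c') lam n'
      = \sum_(1 <= j < n'.+1) (j%:R ^+ c')^-1 * word_fun (b :: w) j.
  case: b lw => lw /=.
    have w0 : w != [::] by case: (w) lw.
    have [-> //] := IH c'.+1 n' lw'.
    by move=> _; apply: eq_bigr => j _; rewrite /opX exprSr invfM mulrA [_^-1 * _]mulrC.
  rewrite big_nat_cond [RHS]big_nat_cond; apply: eq_bigr => j /andP[/andP[j1 _] _].
  have [_ ->] := IH 0%N j.-1 lw'.
  by rewrite prednK // /opY invfM mulrA.
split=> [_|]; first exact: key.
rewrite key [RHS]big_nat_recl //.
(* A nonempty word vanishes at 0, so including j = 0 in the sum changes nothing. *)
have -> : word_fun (b :: w) 0 = 0.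
  by case: b {lw key}; rewrite /= ?/opX ?/opY ?invr0 ?mul0r // big_nil mulr0.
rewrite add0r big_add1; apply: eq_bigr => j _; by rewrite expr0 invr1 mul1r.
Qed.

Lemma Ftrunc_mxeval w N : last false w = false ->
  Ftrunc (word_exps w) lam N = mxeval (xword (mxX K N) (mxY N lam) w).
Proof.
move=> lw; have [_ ->] := Ftrunc_word_fun 0 N lw.
by rewrite mxevalE xword_col big_mkord; apply: eq_bigr => j _; rewrite mxE.
Qed.

Hypothesis lamP : forall n : nat, lam != n.+1%:R.

Lemma word_fun_bounded w : sqrt_bounded (word_fun w).
Proof.
elim: w => [|[] w IH] /=; first exact: sqrt_bounded_e0.
- exact: sqrt_bounded_opX.
- exact: sqrt_bounded_opY.
Qed.

Lemma Fw_cvg w : head false w -> last false w = false ->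
  ((fun N => mxeval (xword (mxX K N) (mxY N lam) w)) : nat -> K^o) @ \oo --> (Fw w lam : K^o).
Proof.
move=> hw lw.
have e : (fun N => mxeval (xword (mxX K N) (mxY N lam) w)) = Ftrunc (word_exps w) lam.
  by apply/funext => N; rewrite Ftrunc_mxeval.
rewrite e; suff : cvg ((Ftrunc (word_exps w) lam : nat -> K^o) @ \oo) by [].
case: w hw lw {e} => // -[] // w _ lw.
have -> : Ftrunc (word_exps (true :: w)) lam = fun N => \sum_(0 <= j < N.+1) opX (word_fun w) j.
  by apply/funext => N; have [_ ->] := Ftrunc_word_fun 0 N lw.
exact: cvg_partial_sums (word_fun_bounded w).
Qed.

(** The vectors at all levels N are truncations of one function, so a single constant bounds them
    uniformly in N. *)
Definition good_vec (z : forall N, 'cV[K]_N.+1) :=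
  exists2 f, sqrt_bounded f & forall N, z N = \col_j f j.

Lemma good_vecX z : good_vec z -> good_vec (fun N => mxX K N *m z N).
Proof.
move=> [f bf hf]; exists (opX f); first exact: sqrt_bounded_opX.
by move=> N; rewrite hf mxX_col.
Qed.

Lemma good_vecY z : good_vec z -> good_vec (fun N => mxY N lam *m z N).
Proof.
move=> [f bf hf]; exists (opY lam f); first exact: sqrt_bounded_opY.
by move=> N; rewrite hf mxY_col.
Qed.

Lemma good_vec_addZ z z' a : good_vec z -> good_vec z' -> good_vec (fun N => z N + a *: z' N).
Proof.
move=> [f bf hf] [g bg hg]; exists (fun j => f j + a * g j); first exact: sqrt_bounded_add.
by move=> N; rewrite hf hg; apply/matrixP => i j; rewrite !mxE.
Qed.

Lemma good_vecC z : good_vec z -> good_vec (fun N => mxC N lam *m z N).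
Proof.
move=> gz.
have h := good_vec_addZ (- lam) (good_vec_addZ 1 (good_vecX gz) (good_vecY gz)) (good_vecX (good_vecY gz)).
case: h => f bf hf; exists f => // N; rewrite -hf /mxC /cornerC !mulmxDl mulNmx -scalemxAl mulmx_vec.
by rewrite scale1r scaleNr.
Qed.

Lemma good_vec_iter (A : forall N, 'M[K]_N.+1) :
  (forall z, good_vec z -> good_vec (fun N => A N *m z N)) ->
  forall q z, good_vec z -> good_vec (fun N => A N ^+ q *m z N).
Proof.
move=> hA; elim=> [|q IH] z gz.
  by case: gz => f bf hf; exists f => // N; rewrite mul1mx.
by case: (hA _ (IH _ gz)) => f bf hf; exists f => // N; rewrite exprS mulmx_vec.
Qed.

Lemma good_vecL s : good_vec (fun N => Lprod (mxC N lam) (mxX K N) (mxY N lam) s *m e0 K N).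
Proof.
elim: s => [|[p q] s IH].
  exists (word_fun [::]); first exact: word_fun_bounded.
  by move=> N; rewrite /Lprod big_nil -(xword_col _ [::]) /xword big_nil.
have h := good_vec_iter good_vecX p (good_vecC (good_vec_iter good_vecY q IH)).
case: h => f bf hf; exists f => // N.
by rewrite /Lprod big_cons !mulmx_vec hf.
Qed.

(** The sum of the entries is O(N^{1/2}) and the factor in front is O(1/N). *)
Lemma good_vec_eval_cvg0 z : good_vec z ->
  ((fun N => (N.+1%:R - lam)^-1 * (ones_row K N *m z N) 0 0) : nat -> K^o) @ \oo --> (0 : K^o).
Proof.
move=> [f bf hf].
have [c c0 hc] := sqrt_bounded_sum bf; have [d d0 hd] := normc_sub_lamV lamP.
have es N : (ones_row K N *m z N) 0 0 = \sum_(0 <= i < N.+1) f i.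
  by rewrite hf mxE big_mkord; apply: eq_bigr => j _; rewrite !mxE mul1r.
have bnd N : normc ((N.+1%:R - lam)^-1 * (ones_row K N *m z N) 0 0) <= c * d / Num.sqrt N.+1%:R.
  rewrite es normcM; apply: le_trans (ler_pM (normc_ge0 _) (normc_ge0 _) (hd _) (hc _)) _.
  have a2 : Num.sqrt N.+1%:R ^+ 2 = N.+1%:R :> R by rewrite sqr_sqrtr.
  have a0 : 0 < Num.sqrt N.+1%:R :> R by rewrite sqrtr_gt0.
  rewrite -[X in d / X]a2; move: (Num.sqrt _) a0 => a a0.
  by rewrite le_eqVlt; apply/orP; left; apply/eqP; field; rewrite gt_eqF.
apply/cvgrPdist_lt => e e0.
have er : (complex.Re e)%:C = e by rewrite RRe_real // gtr0_real.
have e0' : 0 < complex.Re e by rewrite -ltcR er.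
near=> N.
rewrite sub0r normrN -er -[X in X < _]/((normc _)%:C) ltcR.
apply: le_lt_trans (bnd N) _.
(* This is c d / sqrt(N+1) < Re e, solved for N+1. *)
have NM : (c * d / complex.Re e) ^+ 2 < N.+1%:R.
  apply: lt_le_trans (_ : (Num.bound ((c * d / complex.Re e) ^+ 2))%:R <= _).
    by apply: archi_boundP; exact: sqr_ge0.
  rewrite ler_nat ltnW // ltnS; near: N; exact: nbhs_infty_ge.
rewrite ltr_pdivrMr ?sqrtr_gt0 // [ltRHS]mulrC -(ltr_pdivrMr _ _ e0').
apply: le_lt_trans (ler_norm _) _; rewrite -sqrtr_sqr ltr_sqrt //.
Unshelve. all: by end_near.
Qed.
End Words.

(** * Duality as transposition *)

Definition swapw (s : seq (nat * nat)) := [seq (p.2, p.1) | p <- rev s].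

(** The evaluation and the matrices are parameters because g uses the same word polynomials in
    transposed matrices. The lists hold exponents lowered by one, so the positivity conditions
    express k_1 > 1 and l_m > 1. *)
Definition shift_identities (R : realType) (phi : forall N, 'M[R[i]]_N.+1 -> R[i])
    (x y : R[i] -> forall N, 'M[R[i]]_N.+1) (lam : R[i]) :=
  let lam' := lam - 1 in
  let diff0 (U V : R[i] -> forall N, 'M[R[i]]_N.+1 -> 'M[R[i]]_N.+1 -> 'M[R[i]]_N.+1) :=
    ((fun N => phi N (U lam N (x lam N) (y lam N)) - phi N (V lam' N (x lam' N) (y lam' N)))
       : nat -> R[i]^o) @ \oo --> (0 : R[i]^o) in
  [/\ forall s, (0 < (head (0, 0)%N s).1)%N -> (0 < (last (0, 0)%N s).2)%N ->
       diff0 (fun t N X Y => lhs1 t X Y s) (fun t N X Y => rhs1 t X Y s),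
      forall q s, (0 < (last (0, q)%N s).2)%N ->
       diff0 (fun t N X Y => lhs2 t X Y q s) (fun t N X Y => rhs2 t X Y q s),
      forall s p, (0 < (head (p, 0)%N s).1)%N ->
       diff0 (fun t N X Y => lhs3 t X Y s p) (fun t N X Y => rhs3 t X Y s p) &
      forall q s p,
       diff0 (fun t N X Y => lhs4 t X Y q s p) (fun t N X Y => rhs4 t X Y q s p)].

Lemma trmxM_ring (K : numFieldType) N (A B : 'M[K]_N.+1) : (A * B)^T%R = B^T%R * A^T%R.
Proof. exact: trmx_mul. Qed.

Lemma trmxX_ring (K : numFieldType) N (A : 'M[K]_N.+1) n : (A ^+ n)^T%R = A^T%R ^+ n.
Proof.
elim: n => [|n IH]; first by rewrite !expr0 trmx1.
by rewrite exprS exprSr trmxM_ring IH.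
Qed.

Lemma swapw_cons a s : swapw (a :: s) = rcons (swapw s) (a.2, a.1).
Proof. by rewrite /swapw rev_cons map_rcons. Qed.

Lemma swapw_rcons a s : swapw (rcons s a) = (a.2, a.1) :: swapw s.
Proof. by rewrite /swapw rev_rcons. Qed.

Lemma trmx_Lprod (K : numFieldType) N (c x y : 'M[K]_N.+1) s :
  (Lprod c x y s)^T%R = Lprod c^T%R y^T%R x^T%R (swapw s).
Proof.
elim: s => [|a s IH]; first by rewrite /Lprod !big_nil trmx1.
rewrite swapw_cons /Lprod -cats1 big_cat big_seq1 big_cons /= !trmxM_ring !trmxX_ring.
by move: IH; rewrite /Lprod => ->; rewrite !mulrA.
Qed.

Lemma Mprod_cons2 (A : nzRingType) (d x y : A) a b s :
  Mprod d x y [:: a, b & s] = x ^+ a.1 * y ^+ a.2 * (d * Mprod d x y (b :: s)).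
Proof. by []. Qed.

Lemma Mprod_rcons (A : nzRingType) (d x y : A) s a : s != [::] ->
  Mprod d x y (rcons s a) = Mprod d x y s * d * (x ^+ a.1 * y ^+ a.2).
Proof.
elim: s => // b [|c s] IH _; first by rewrite /= !mulr1 mulrA.
by rewrite !rcons_cons !Mprod_cons2 -rcons_cons IH // !mulrA.
Qed.

Lemma trmx_Mprod (K : numFieldType) N (d x y : 'M[K]_N.+1) s :
  (Mprod d x y s)^T%R = Mprod d^T%R y^T%R x^T%R (swapw s).
Proof.
elim: s => [|a [|b s] IH]; first by rewrite /= trmx1.
  by rewrite /= !mulr1 trmxM_ring !trmxX_ring.
rewrite swapw_cons Mprod_rcons; last by rewrite /swapw rev_cons map_rcons; case: map.
rewrite -IH Mprod_cons2.
by rewrite !trmxM_ring !trmxX_ring.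
Qed.

Section Transposition.
Variable K : numFieldType.

Lemma trmxZ_ring N a (A : 'M[K]_N.+1) : (a *: A)^T%R = a *: A^T%R.
Proof. exact: linearZ. Qed.

(** Reversing the product and exchanging the letters cancel out, so the corners keep their form;
    this is why g satisfies identities of the same shape as f. *)
Lemma trmx_cornerC N lam (x y : 'M[K]_N.+1) : (cornerC lam x y)^T%R = cornerC lam y^T%R x^T%R.
Proof. by rewrite /cornerC !linearD linearN /= trmxZ_ring trmxM_ring [x^T + _]addrC. Qed.

Lemma trmx_cornerD N lam (x y : 'M[K]_N.+1) : (cornerD lam x y)^T%R = cornerD lam y^T%R x^T%R.
Proof. by rewrite /cornerD !linearD linearN /= trmxZ_ring trmxM_ring [x^T + _]addrC. Qed.

Lemma trmx_1sub N lam (x : 'M[K]_N.+1) : (1 - lam *: x)^T%R = 1 - lam *: x^T%R.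
Proof. by rewrite linearB /= trmxZ_ring trmx1. Qed.

Lemma head_swapw a s : (head a (swapw s)) = ((last (a.2, a.1) s).2, (last (a.2, a.1) s).1).
Proof.
case/lastP: s => [|s b]; first by case: a.
by rewrite swapw_rcons last_rcons.
Qed.

Lemma last_swapw a s : (last a (swapw s)) = ((head (a.2, a.1) s).2, (head (a.2, a.1) s).1).
Proof.
case: s => [|b s]; first by case: a.
by rewrite swapw_cons last_rcons.
Qed.

Definition trmxE := (trmxM_ring, trmxX_ring, trmx_Lprod, trmx_Mprod, trmx_cornerC, trmx_cornerD,
  trmx_1sub, @trmxK).

Lemma trmx_lhs1 N t (x y : 'M[K]_N.+1) s :
  (lhs1 t y^T%R x^T%R s)^T%R = lhs1 t x y (swapw s).
Proof. by rewrite /lhs1 !trmxE. Qed.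

Lemma trmx_rhs1 N t (x y : 'M[K]_N.+1) s :
  (rhs1 t y^T%R x^T%R s)^T%R = rhs1 t x y (swapw s).
Proof. by rewrite /rhs1 trmxZ_ring !trmxE mulrA. Qed.

Lemma trmx_lhs2 N t (x y : 'M[K]_N.+1) q s :
  (lhs2 t y^T%R x^T%R q s)^T%R = lhs3 t x y (swapw s) q.
Proof. by rewrite /lhs2 /lhs3 !trmxE !mulrA. Qed.

Lemma trmx_rhs2 N t (x y : 'M[K]_N.+1) q s :
  (rhs2 t y^T%R x^T%R q s)^T%R = rhs3 t x y (swapw s) q.
Proof. by rewrite /rhs2 /rhs3 -(swapw_cons (0, q)%N); move: (_ :: s) => s'; rewrite !trmxE mulrA. Qed.

Lemma trmx_lhs3 N t (x y : 'M[K]_N.+1) s p :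
  (lhs3 t y^T%R x^T%R s p)^T%R = lhs2 t x y p (swapw s).
Proof. by rewrite /lhs2 /lhs3 !trmxE !mulrA. Qed.

Lemma trmx_rhs3 N t (x y : 'M[K]_N.+1) s p :
  (rhs3 t y^T%R x^T%R s p)^T%R = rhs2 t x y p (swapw s).
Proof. by rewrite /rhs2 /rhs3 -(swapw_rcons (p, 0)%N); move: (rcons s _) => s'; rewrite !trmxE mulrA. Qed.

Lemma trmx_lhs4 N t (x y : 'M[K]_N.+1) q s p :
  (lhs4 t y^T%R x^T%R q s p)^T%R = lhs4 t x y p (swapw s) q.
Proof. by rewrite /lhs4 !trmxE !mulrA. Qed.

Lemma trmx_rhs4 N t (x y : 'M[K]_N.+1) q s p :
  (rhs4 t y^T%R x^T%R q s p)^T%R = rhs4 t x y p (swapw s) q.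
Proof.
rewrite /rhs4 -(swapw_cons (0, q)%N) -(swapw_rcons (p, 0)%N) rcons_cons.
by move: (_ :: rcons s _) => s'; rewrite trmxZ_ring !trmxE mulrA.
Qed.

End Transposition.

(** * The asymptotic identities for f and for g *)

Section Realizations.
Variables (R : realType).
Local Notation K := R[i].

Lemma eqlim0 (u : nat -> K) : (forall n, u n = 0) -> (u : nat -> K^o) @ \oo --> (0 : K^o).
Proof.
move=> u0; apply/cvgrPdist_lt => e e_gt0.
by near=> n; rewrite u0 subrr normr0.
Unshelve. all: by end_near.
Qed.

Lemma eqlim_congr (u v : nat -> K) (a : K) : (forall n, v n = u n) ->
  (u : nat -> K^o) @ \oo --> (a : K^o) -> (v : nat -> K^o) @ \oo --> (a : K^o).
Proof. by move=> e; have -> : v = u by apply/funext. Qed.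

Lemma shift_identities_f lam : (forall n : nat, lam != n.+1%:R) ->
  shift_identities (fun N => @mxeval K N) (fun _ N => mxX K N) (fun lam N => mxY N lam) lam.
Proof.
move=> lamP; split=> [s _ ls|q s ls|s p _|q s p].
- by apply: eqlim0 => N; exact: (shift_trunc1 N lamP ls).
- rewrite (eq_cvg _ _ (fun N => shift_trunc2 N lamP ls)).
  rewrite (eq_cvg _ _ (fun N => congr1 _ (mxeval_vec _))).
  apply: good_vec_eval_cvg0 => //.
  have [f bf hf] := good_vec_iter (good_vecY lamP) q (good_vecL lamP s).
  by exists f => // N; rewrite mulmx_vec hf.
- by apply: eqlim0 => N; exact: (shift_trunc3 N lamP).
- rewrite (eq_cvg _ _ (fun N => shift_trunc4 N lamP q s p)).
  rewrite (eq_cvg _ _ (fun N => congr1 _ (mxeval_vec _))).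
  apply: good_vec_eval_cvg0 => //.
  have [f bf hf] := good_vec_iter (good_vecY lamP) q (good_vecL lamP (rcons s (p, 0)%N)).
  by exists f => // N; rewrite mulmx_vec hf.
Qed.

(** Transposition exchanges the two ends of the word: (i) and (iv) for g come from the same case for
    f, whereas (ii) comes from (iii) and (iii) from (ii). *)
Lemma shift_identities_g lam : (forall n : nat, lam != n.+1%:R) ->
  shift_identities (fun N A => mxeval A^T%R) (fun lam N => (mxY N lam)^T%R)
    (fun _ N => (mxX K N)^T%R) lam.
Proof.
move=> /shift_identities_f [h1 h2 h3 h4]; split=> [s hs ls|q s ls|s p hs|q s p].
- have := h1 (swapw s); rewrite head_swapw last_swapw => /(_ ls hs).
  by apply: eqlim_congr => N; rewrite trmx_lhs1 trmx_rhs1.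
- have := h3 (swapw s) q; rewrite head_swapw => /(_ ls).
  by apply: eqlim_congr => N; rewrite trmx_lhs2 trmx_rhs2.
- have := h2 p (swapw s); rewrite last_swapw => /(_ hs).
  by apply: eqlim_congr => N; rewrite trmx_lhs3 trmx_rhs3.
- have := h4 p (swapw s) q.
  by apply: eqlim_congr => N; rewrite trmx_lhs4 trmx_rhs4.
Qed.
End Realizations.

(** * Passage to the limit *)

Lemma iota1_rcons m : (0 < m)%N -> iota 1 m = rcons (iota 1 m.-1) m.
Proof. by move=> m0; have := iotaD 1 m.-1 1; rewrite addn1 add1n prednK // => ->; rewrite cats1. Qed.

Section Limits.
Variables (R : realType) (phi : forall N, 'M[R[i]]_N.+1 -> R[i]).
Hypothesis phi_scalar : forall N, scalar (@phi N).
Local Notation K := R[i].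

Definition eval_cvg (F : forall N, 'M[K]_N.+1) (S : K) :=
  ((fun N => @phi N (F N)) : nat -> K^o) @ \oo --> (S : K^o).

Lemma phi0 N : @phi N 0 = 0.
Proof. by have := @phi_scalar N (-1) 0 0; rewrite scaler0 addr0 mulN1r addNr. Qed.

Lemma eval_cvgZ F S c : eval_cvg F S -> eval_cvg (fun N => c *: F N) (c * S).
Proof.
rewrite /eval_cvg => h.
have -> : (fun N => @phi N (c *: F N)) = (fun N => c * @phi N (F N)).
  by apply/funext => N; have := @phi_scalar N c (F N) 0; rewrite addr0 phi0 addr0.
exact: (@cvgMr _ _ _ _ _ c _ h).
Qed.

Lemma eval_cvg_sum (T : Type) (r : seq T) (F : T -> forall N, 'M[K]_N.+1) (S : T -> K) :
  List.Forall (fun i => eval_cvg (F i) (S i)) r ->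
  eval_cvg (fun N => \sum_(i <- r) F i N) (\sum_(i <- r) S i).
Proof.
elim=> [|i s hi _ IH]; rewrite /eval_cvg.
  rewrite big_nil; apply: eqlim0 => N; by rewrite big_nil phi0.
rewrite big_cons.
have -> : (fun N => @phi N (\sum_(j <- i :: s) F j N))
  = (fun N => @phi N (F i N) + @phi N (\sum_(j <- s) F j N)).
  apply/funext => N; rewrite big_cons -[F i N in LHS]scale1r phi_scalar.
  by rewrite mul1r.
exact: (@cvgD _ K^o _ _ _ _ _ _ _ hi IH).
Qed.

(** The word starts with x, which gives convergence, and ends with y. The case distinction on k_1
    and l_m keeps all tuples of the sums of this kind. *)
Definition admissible (kl : seq (nat * nat)) :=
  ((0 < (head (0, 0) kl).1) && (0 < (last (0, 0) kl).2))%N.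

Variables (G : forall N, seq (nat * nat) -> 'M[K]_N.+1) (H : seq (nat * nat) -> K).
Hypothesis GH : forall kl, admissible kl -> eval_cvg (fun N => G N kl) (H kl).
Variables (t : K) (m : nat) (k l : nat -> nat).
Hypothesis m_gt0 : (0 < m)%N.
Hypothesis kl_gt0 : forall i, (1 <= i <= m)%N -> (1 <= k i)%N /\ (1 <= l i)%N.

Lemma Iset_le1 a : a \in Iset -> (a.1 <= 1)%N /\ (a.2 <= 1)%N.
Proof. by rewrite !inE => /or3P[] /eqP ->. Qed.

Lemma Forall01 (P : nat -> Prop) : (forall d, (d <= 1)%N -> P d) -> List.Forall P [:: 0; 1]%N.
Proof. by move=> h; constructor; [exact: h|constructor; [exact: h|constructor]]. Qed.

Lemma admissible_iota (a b : nat -> nat) : (0 < a 1)%N -> (0 < b m)%N ->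
  admissible [seq (a i, b i) | i <- iota 1 m].
Proof.
move=> a1 bm; apply/andP; split; first by rewrite -(prednK m_gt0).
by rewrite (iota1_rcons m_gt0) map_rcons last_rcons.
Qed.

Lemma sumL1_cvg : (1 < k 1)%N -> (1 < l m)%N ->
  eval_cvg (fun N => sumL1 t m k l (G N)) (sumL1 (V := K^o) t m k l H).
Proof.
move=> k1 lm; apply: eval_cvg_sum.
apply: List.Forall_impl (families_Forall Iset 1 m) => p hp; apply: eval_cvgZ; apply: GH.
have [p1 _] := Iset_le1 (hp 1%N ltac:(lia)); have [_ pm] := Iset_le1 (hp m ltac:(lia)).
by apply: (@admissible_iota (fun i => k i - (p i).1)%N (fun i => l i - (p i).2)%N); lia.
Qed.

Lemma sumL2_cvg : k 1 = 1%N -> (1 < l m)%N ->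
  eval_cvg (fun N => sumL2 t m k l (G N)) (sumL2 (V := K^o) t m k l H).
Proof.
move=> k1 lm; apply: eval_cvg_sum; apply: Forall01 => d d1; apply: eval_cvg_sum.
apply: List.Forall_impl (families_Forall Iset 2 m.-1) => p hp; apply: eval_cvgZ; apply: GH.
(* The separate first pair is folded into a map over all blocks, which also covers m = 1, where it
   is the last pair too. *)
rewrite [X in admissible X](_ : _ =
  [seq ((if i == 1 then 1 else k i - (p i).1), (if i == 1 then l 1 - d else l i - (p i).2))%N
  | i <- iota 1 m]); last first.
  rewrite -[in RHS](prednK m_gt0) /=; congr (_ :: _); apply/eq_in_map => i; rewrite mem_iota => hi.
  by have -> : (i == 1)%N = false by lia.
apply: (@admissible_iota (fun i => if i == 1 then 1 else k i - (p i).1)%N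
  (fun i => if i == 1 then l 1 - d else l i - (p i).2)%N) => //.
case: eqP => [e|ne]; first by rewrite -e; lia.
have [_ pm] := Iset_le1 (hp m ltac:(lia)); lia.
Qed.

Lemma sumL3_cvg : (1 < k 1)%N -> l m = 1%N ->
  eval_cvg (fun N => sumL3 t m k l (G N)) (sumL3 (V := K^o) t m k l H).
Proof.
move=> k1 lm; apply: eval_cvg_sum.
apply: List.Forall_impl (families_Forall Iset 1 m.-1) => p hp.
apply: eval_cvg_sum; apply: Forall01 => d d1; apply: eval_cvgZ; apply: GH.
rewrite [X in admissible X](_ : _ =
  [seq ((if i == m then k m - d else k i - (p i).1), (if i == m then 1 else l i - (p i).2))%N
  | i <- iota 1 m]); last first.
  rewrite (iota1_rcons m_gt0) map_rcons eqxx -cats1.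
  congr (_ ++ _); apply/eq_in_map => i; rewrite mem_iota => hi.
  by have -> : (i == m)%N = false by lia.
apply: (@admissible_iota (fun i => if i == m then k m - d else k i - (p i).1)%N
  (fun i => if i == m then 1 else l i - (p i).2)%N); last by rewrite eqxx.
case: eqP => [e|ne]; first by rewrite -e; lia.
have [p1 _] := Iset_le1 (hp 1%N ltac:(lia)); lia.
Qed.

Lemma sumL4_cvg : (1 < m)%N -> k 1 = 1%N -> l m = 1%N ->
  eval_cvg (fun N => sumL4 t m k l (G N)) (sumL4 (V := K^o) t m k l H).
Proof.
move=> m1 k1 lm; apply: eval_cvg_sum; apply: Forall01 => e e1; apply: eval_cvg_sum.
apply: List.Forall_impl (families_Forall Iset 2 (m - 2)) => p hp.
apply: eval_cvg_sum; apply: Forall01 => d d1; apply: eval_cvgZ; apply: GH.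
by rewrite /admissible /= last_cat.
Qed.

(** The inner corners never touch the first x-exponent or the last y-exponent; these are k_1 - d and
    l_m - e. *)
Lemma sumR_cvg ds es : all (fun d => d < k 1)%N ds -> all (fun e => e < l m)%N es ->
  eval_cvg (fun N => sumR t m k l (G N) ds es) (sumR (V := K^o) t m k l H ds es).
Proof.
have Forall_all (P : pred nat) s : all P s -> List.Forall P s.
  by elim: s => [|a s IH] /= => [_|/andP[pa /IH ?]]; constructor.
move=> /Forall_all hd /Forall_all he; apply: eval_cvg_sum.
apply: List.Forall_impl hd => d dk; apply: eval_cvg_sum.
apply: List.Forall_impl (families_Forall Iset 2 m.-1) => q _; apply: eval_cvg_sum.
apply: List.Forall_impl he => e el; apply: eval_cvgZ; apply: GH.
apply: (@admissible_iota (fun i => k i - (if i == 1 then d else (q i).1))%N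
  (fun i => l i - (if i == m then e else (q i.+1).2))%N); rewrite eqxx; lia.
Qed.
End Limits.

(** * f and g as limits of matrix evaluations *)

Section Realization.
Variable R : realType.
Local Notation K := R[i].

Lemma lim_eq (u v : nat -> K) (a b : K) :
  (u : nat -> K^o) @ \oo --> (a : K^o) -> (v : nat -> K^o) @ \oo --> (b : K^o) ->
  ((fun n => u n - v n) : nat -> K^o) @ \oo --> (0 : K^o) -> a = b.
Proof.
move=> ua vb uv; apply/eqP; rewrite -subr_eq0; apply/eqP.
exact: (cvg_unique _ (@cvgB _ K^o _ _ _ _ _ _ _ ua vb) uv).
Qed.

(* [phi] evaluates truncated words; [x] and [y] are matrices of size N+1 depending on lam.  For f
   these are mxX and mxY, for g they are the transposes of mxY and mxX. *)
Definition realizes (h : seq (nat * nat) -> K -> K) (phi : forall N, 'M[K]_N.+1 -> K)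
    (x y : K -> forall N, 'M[K]_N.+1) :=
  (forall N, scalar (@phi N)) /\
  forall lam : K, (forall n : nat, lam != n.+1%:R) ->
    (forall kl, admissible kl ->
       eval_cvg phi (fun N => xword (x lam N) (y lam N) (xyword kl)) (h kl lam))
    /\ shift_identities phi x y lam.

Lemma head_xyword kl : (0 < (head (0, 0)%N kl).1)%N -> head false (xyword kl).
Proof. by case: kl => // -[[|a] b] s. Qed.

Lemma last_xyword kl b : (0 < (last (0, 0)%N kl).2)%N -> last b (xyword kl) = false.
Proof.
case/lastP: kl => // s [a c]; rewrite last_rcons /= => c0.
rewrite /xyword map_rcons flatten_rcons !last_cat /=.
by case: c c0 => // c _; elim: c.
Qed.

Lemma realizes_f : realizes (@fS R) (fun N => @mxeval K N) (fun _ N => mxX K N)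
  (fun lam N => mxY N lam).
Proof.
split=> [N|lam lamP]; first exact: mxeval_scalar.
split=> [kl /andP[h1 h2]|]; last exact: shift_identities_f.
by apply: Fw_cvg => //; [exact: head_xyword|exact: last_xyword].
Qed.

(** With corner 1 a plain word is an [Lprod], so [trmx_Lprod] also computes its transpose. *)
Lemma xword_Lprod (A : algType K) (x y : A) kl : xword x y (xyword kl) = Lprod 1 x y kl.
Proof. by rewrite xword_xyword /Lprod; apply: eq_bigr => p _; rewrite mulr1. Qed.

Lemma realizes_g : realizes (@gS R) (fun N A => mxeval A^T%R)
  (fun lam N => (mxY N lam)^T%R) (fun _ N => (mxX K N)^T%R).
Proof.
split=> [N a A B|lam lamP]; first by rewrite linearP; exact: mxeval_scalar.
split=> [kl /andP[h1 h2]|]; last exact: shift_identities_g.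
have : admissible (swapw kl) by rewrite /admissible head_swapw last_swapw h1 h2.
move=> /(realizes_f.2 lam lamP).1; rewrite /eval_cvg.
apply: eqlim_congr => N; congr mxeval.
by rewrite !xword_Lprod trmx_Lprod trmx1 !trmxK.
Qed.
End Realization.

(** * The four cases, for f and g alike *)

Section Cases.
Variables (R : realType) (h : seq (nat * nat) -> R[i] -> R[i]).
Local Notation K := R[i].
Variables (phi : forall N, 'M[K]_N.+1 -> K) (x y : K -> forall N, 'M[K]_N.+1).
Hypothesis hphi : realizes h phi x y.
Variables (lam : K) (m : nat) (k l : nat -> nat).
Hypothesis lamP : forall n : nat, lam != n.+1%:R.
Hypothesis m_gt0 : (0 < m)%N.
Hypothesis kl_gt0 : forall i, (1 <= i <= m)%N -> (1 <= k i)%N /\ (1 <= l i)%N.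

Let G t N kl := xword (x t N) (y t N) (xyword kl).

Lemma lamB1P n : lam - 1 != n.+1%:R.
Proof. by rewrite subr_eq natr1 lamP. Qed.

(** The value lam = 1 is excluded; this makes the exponent -1 on the right-hand side meaningful. *)
Lemma lamB1_neq0 : - (lam - 1) != 0.
Proof. by rewrite oppr_eq0 subr_eq0 -[1]/(1%:R) lamP. Qed.

Lemma shift_eq (SL SR : K) (FL FR FL' FR' : forall N, 'M[K]_N.+1) :
  eval_cvg phi FL SL -> eval_cvg phi FR SR ->
  (forall N, FL N = FL' N) -> (forall N, FR N = FR' N) ->
  ((fun N => phi (FL' N) - phi (FR' N)) : nat -> K^o) @ \oo --> (0 : K^o) -> SL = SR.
Proof.
move=> cL cR eL eR d; apply: (lim_eq cL cR).
by move: d; apply: eqlim_congr => N; rewrite eL eR.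
Qed.

Let GH t : (forall n : nat, t != n.+1%:R) -> forall kl, admissible kl ->
  eval_cvg phi (fun N => G t N kl) (h kl t).
Proof. by move=> tP; exact: (hphi.2 t tP).1. Qed.

Let k1_gt0 : (0 < k 1)%N. Proof. by apply: (kl_gt0 _).1; rewrite m_gt0. Qed.
Let lm_gt0 : (0 < l m)%N. Proof. by apply: (kl_gt0 _).2; rewrite m_gt0 leqnn. Qed.

Lemma head_pred_pairs n d : (head d (pred_pairs k l 1 n.+1)).1 = (k 1).-1.
Proof. by []. Qed.

Lemma last_pred_pairs lo n d : (last d (pred_pairs k l lo n.+1)).2 = (l (lo + n)%N).-1.
Proof. by rewrite pred_pairs_rcons last_rcons. Qed.

Lemma shift_case1 : (1 < k 1)%N -> (1 < l m)%N ->
  sumL1 (V := K^o) (- lam) m k l (h^~ lam)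
  = sumR (V := K^o) (- (lam - 1)) m k l (h^~ (lam - 1)) [:: 0; 1]%N [:: 0; 1]%N.
Proof.
move=> hk hl; have [s _ _ _] := (hphi.2 lam lamP).2.
have cL := sumL1_cvg hphi.1 (GH lamP) (t := - lam) m_gt0 hk hl.
apply: (shift_eq cL (sumR_cvg hphi.1 (GH lamB1P) (t := - (lam - 1)) m_gt0
  (ds := [:: 0; 1]%N) (es := [:: 0; 1]%N) _ _)).
- by rewrite /= k1_gt0 hk.
- by rewrite /= lm_gt0 hl.
- by move=> N; apply: sumL1_form.
- by move=> N; apply: sumR1_form => //; exact: lamB1_neq0.
apply: s; rewrite -(prednK m_gt0).
  by rewrite head_pred_pairs; lia.
by rewrite last_pred_pairs add1n prednK //; lia.
Qed.

Lemma shift_case2 : k 1 = 1%N -> (1 < l m)%N ->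
  sumL2 (V := K^o) (- lam) m k l (h^~ lam)
  = sumR (V := K^o) (- (lam - 1)) m k l (h^~ (lam - 1)) [:: 0]%N [:: 0; 1]%N.
Proof.
move=> hk hl; have [_ s _ _] := (hphi.2 lam lamP).2.
have cL := sumL2_cvg hphi.1 (GH lamP) (t := - lam) m_gt0 hk hl.
apply: (shift_eq cL (sumR_cvg hphi.1 (GH lamB1P) (t := - (lam - 1)) m_gt0
  (ds := [:: 0]%N) (es := [:: 0; 1]%N) _ _)).
- by rewrite /= k1_gt0.
- by rewrite /= lm_gt0 hl.
- by move=> N; apply: sumL2_form.
- by move=> N; apply: sumR2_form => //; exact: lamB1_neq0.
(* For m = 1 the list is empty and the last pair is (0, l_1 - 1) itself. *)
apply: s; case: (m) m_gt0 hl => // -[|n] _ hl; first by rewrite /=; lia.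
by rewrite succnK last_pred_pairs add2n; lia.
Qed.

Lemma shift_case3 : (1 < k 1)%N -> l m = 1%N ->
  sumL3 (V := K^o) (- lam) m k l (h^~ lam)
  = sumR (V := K^o) (- (lam - 1)) m k l (h^~ (lam - 1)) [:: 0; 1]%N [:: 0]%N.
Proof.
move=> hk hl; have [_ _ s _] := (hphi.2 lam lamP).2.
have cL := sumL3_cvg hphi.1 (GH lamP) (t := - lam) m_gt0 hk hl.
apply: (shift_eq cL (sumR_cvg hphi.1 (GH lamB1P) (t := - (lam - 1)) m_gt0
  (ds := [:: 0; 1]%N) (es := [:: 0]%N) _ _)).
- by rewrite /= k1_gt0 hk.
- by rewrite /= lm_gt0.
- by move=> N; apply: sumL3_form.
- by move=> N; apply: sumR3_form => //; exact: lamB1_neq0.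
apply: s; case: (m) m_gt0 => // -[|n] _ /=; lia.
Qed.

Lemma shift_case4 : k 1 = 1%N -> l m = 1%N -> (1 < m)%N ->
  sumL4 (V := K^o) (- lam) m k l (h^~ lam)
  = sumR (V := K^o) (- (lam - 1)) m k l (h^~ (lam - 1)) [:: 0]%N [:: 0]%N.
Proof.
move=> hk hl m2; have [_ _ _ s] := (hphi.2 lam lamP).2.
have cL := sumL4_cvg hphi.1 (GH lamP) (t := - lam) m2 hk hl.
apply: (shift_eq cL (sumR_cvg hphi.1 (GH lamB1P) (t := - (lam - 1)) m_gt0
  (ds := [:: 0]%N) (es := [:: 0]%N) _ _)).
- by rewrite /= k1_gt0.
- by rewrite /= lm_gt0.
- by move=> N; apply: sumL4_form.
- by move=> N; apply: sumR4_form => //; exact: lamB1_neq0.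
exact: s.
Qed.
End Cases.
Unset Implicit Arguments.

Theorem theorem3p1 (R : realType) (h : seq (nat * nat) -> R[i] -> R[i])
    (m : nat) (k l : nat -> nat) (lam : R[i]) :
  (h = @fS R \/ h = @gS R) ->
  (1 <= m)%N ->
  (forall i, (1 <= i <= m)%N -> (1 <= k i)%N /\ (1 <= l i)%N) ->
  (forall n : nat, lam != n.+1%:R) ->
  [/\
  (* (i) *)
  (k 1 != 1)%N -> (l m != 1)%N ->
    \sum_(p <- families Iset 1 m)
       (- lam) ^ (m%:Z - (\sum_(1 <= i < m.+1) (p i).1)%N%:Z
                       - (\sum_(1 <= i < m.+1) (p i).2)%N%:Z)
       * h [seq (k i - (p i).1, l i - (p i).2)%N | i <- iota 1 m] lam
    = \sum_(d1 <- [:: 0; 1]%N) \sum_(q <- families Iset 2 m.-1)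
        \sum_(e <- [:: 0; 1]%N)
       (- (lam - 1)) ^ (m%:Z - (d1 + \sum_(2 <= j < m.+1) (q j).1)%N%:Z
                             - (\sum_(2 <= j < m.+1) (q j).2 + e)%N%:Z)
       * h [seq (k i - (if i == 1 then d1 else (q i).1),
                 l i - (if i == m then e else (q i.+1).2))%N
             | i <- iota 1 m] (lam - 1),
  (* (ii) *)
  (k 1 = 1)%N -> (l m != 1)%N ->
    \sum_(e1 <- [:: 0; 1]%N) \sum_(p <- families Iset 2 m.-1)
       (- lam) ^ (m%:Z - (\sum_(2 <= i < m.+1) (p i).1)%N%:Z
                       - (e1 + \sum_(2 <= i < m.+1) (p i).2)%N%:Z)
       * h ((1, l 1 - e1)%N
             :: [seq (k i - (p i).1, l i - (p i).2)%N | i <- iota 2 m.-1]) lam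
    = \sum_(q <- families Iset 2 m.-1) \sum_(e <- [:: 0; 1]%N)
       (- (lam - 1)) ^ (m%:Z - (\sum_(2 <= j < m.+1) (q j).1)%N%:Z
                             - (\sum_(2 <= j < m.+1) (q j).2 + e)%N%:Z)
       * h ((1, l 1 - (if m == 1 then e else (q 2).2))%N
             :: [seq (k i - (q i).1, l i - (if i == m then e else (q i.+1).2))%N
                | i <- iota 2 m.-1]) (lam - 1),
  (* (iii) *)
  (k 1 != 1)%N -> (l m = 1)%N ->
    \sum_(p <- families Iset 1 m.-1) \sum_(dm <- [:: 0; 1]%N)
       (- lam) ^ (m%:Z - (\sum_(1 <= i < m) (p i).1 + dm)%N%:Z
                       - (\sum_(1 <= i < m) (p i).2)%N%:Z)
       * h ([seq (k i - (p i).1, l i - (p i).2)%N | i <- iota 1 m.-1]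
             ++ [:: (k m - dm, 1)%N]) lam
    = \sum_(d1 <- [:: 0; 1]%N) \sum_(q <- families Iset 2 m.-1)
       (- (lam - 1)) ^ (m%:Z - (d1 + \sum_(2 <= j < m.+1) (q j).1)%N%:Z
                             - (\sum_(2 <= j < m.+1) (q j).2)%N%:Z)
       * h ([seq (k i - (if i == 1 then d1 else (q i).1), l i - (q i.+1).2)%N
             | i <- iota 1 m.-1]
             ++ [:: (k m - (if m == 1 then d1 else (q m).1), 1)%N]) (lam - 1) &
  (* (iv) *)
  (k 1 = 1)%N -> (l m = 1)%N -> (2 <= m)%N ->
    \sum_(e1 <- [:: 0; 1]%N) \sum_(p <- families Iset 2 (m - 2))
        \sum_(dm <- [:: 0; 1]%N)
       (- lam) ^ (m%:Z - (\sum_(2 <= i < m) (p i).1 + dm)%N%:Z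
                       - (e1 + \sum_(2 <= i < m) (p i).2)%N%:Z)
       * h ((1, l 1 - e1)%N
             :: [seq (k i - (p i).1, l i - (p i).2)%N | i <- iota 2 (m - 2)]
             ++ [:: (k m - dm, 1)%N]) lam
    = \sum_(q <- families Iset 2 m.-1)
       (- (lam - 1)) ^ (m%:Z - (\sum_(2 <= j < m.+1) (q j).1)%N%:Z
                             - (\sum_(2 <= j < m.+1) (q j).2)%N%:Z)
       * h ((1, l 1 - (q 2).2)%N
             :: [seq (k i - (q i).1, l i - (q i.+1).2)%N | i <- iota 2 (m - 2)]
             ++ [:: (k m - (q m).1, 1)%N]) (lam - 1)
  ].
Proof.
move=> hfg m1 kl_gt0 lamP.
have [phi [x [y hphi]]] : exists phi x y, @realizes R h phi x y.
  by case: hfg => ->; do 3 eexists; [exact: realizes_f|exact: realizes_g].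
have k1_gt0 : (0 < k 1)%N by apply: (kl_gt0 _ _).1; rewrite m1.
have lm_gt0 : (0 < l m)%N by apply: (kl_gt0 _ _).2; rewrite m1 leqnn.
split=> [k1 lm|k1 lm|k1 lm|k1 lm m2].
- by apply: (shift_case1 hphi) => //; lia.
- rewrite [LHS](shift_case2 hphi lamP m1 kl_gt0 k1); last by lia.
  rewrite /sumR big_seq1; apply: eq_bigr => q _; apply: eq_bigr => e _.
  (* The first block is split off, which settles the test i == 1; the test i == m stays, since for m
     = 1 this block is also the last. *)
  congr (_ * h _ _); rewrite /shifted_pairs -[in iota 1 m](prednK m1) /= subn0 k1.
  congr ((_, l 1 - _)%N :: _); first by rewrite eq_sym.
  apply/eq_in_map => i; rewrite mem_iota => hi.
  by have -> : (i == 1)%N = false by lia.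
- rewrite [LHS](shift_case3 hphi lamP m1 kl_gt0 _ lm); last by lia.
  apply: eq_bigr => d _; apply: eq_bigr => q _; rewrite big_seq1 addn0.
  congr (_ * h _ _); rewrite /shifted_pairs (iota1_rcons m1) map_rcons -cats1 eqxx subn0 lm.
  congr (_ ++ _); apply/eq_in_map => i; rewrite mem_iota => hi.
  by have -> : (i == m) = false by lia.
- rewrite [LHS](shift_case4 hphi lamP m1 kl_gt0 k1 lm m2).
  rewrite /sumR big_seq1; apply: eq_bigr => q _; rewrite big_seq1 addn0.
  congr (_ * h _ _); rewrite /shifted_pairs (iota1_rcons m1) map_rcons -cats1 eqxx subn0 lm.
  have -> : m.-1 = (m - 2).+1 by lia.
  have -> : (m == 1)%N = false by lia.
  rewrite /= subn0 k1 (_ : (1 == m)%N = false); last by lia.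
  congr (_ :: _ ++ _); apply/eq_in_map => i; rewrite mem_iota => hi.
  have -> : (i == m) = false by lia.
  by have -> : (i == 1)%N = false by lia.
Qed.
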